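(* Let $(E,[\![\cdot,\cdot]\!],\rho)$ be a Lie algebroid of rank $m$ over a manifold $Q$ of dimension $n$, and let $L:E\times\mathbb{R}\to\mathbb{R}$ be a regular Lagrangian, with associated contact section $\eta_L$, Reeb section $\mathcal{R}_L$ and energy $E_L$. Then there exists a unique section $\Gamma_L:E\times\mathbb{R}\to\mathcal{T}^E(E\times\mathbb{R})$ of $\widetilde\tau_{E\times\mathbb{R}}$ (called the Lagrangian section) satisfying $$\imath_{\Gamma_L}\eta_L=-E_L,\qquad \imath_{\Gamma_L}\mathrm{d}\eta_L=\mathrm{d}E_L-\rho^{\pi}(\mathcal{R}_L)(E_L)\,\eta_L .$$ Moreover: 1. $\Gamma_L$ is a second order differential equation (SODE), i.e. $S(\Gamma_L)=\Delta$. 2. If $\widetilde c:I\subset\mathbb{R}\to E\times\mathbb{R}$, $\widetilde c(t)=(q^i(t),y^\alpha(t),s(t))$ in local coordinates, is an integral curve of $\Gamma_L$, then $\widetilde c$ is a solution of the system (the Herglotz equations on Lie algebroids) $$\frac{\mathrm{d}}{\mathrm{d}t}\left(\frac{\partial L}{\partial y^\alpha}\Big|_{\widetilde c(t)}\right)=\rho^i_\alpha(q(t))\,\frac{\partial L}{\partial q^i}\Big|_{\widetilde c(t)}-y^\beta(t)\,\mathcal{C}^\gamma_{\alpha\beta}(q(t))\,\frac{\partial L}{\partial y^\gamma}\Big|_{\widetilde c(t)}+\frac{\partial L}{\partial y^\alpha}\Big|_{\widetilde c(t)}\frac{\partial L}{\partial s}\Big|_{\widetilde c(t)},$$ $$\frac{\mathrm{d}q^i}{\mathrm{d}t}=y^\alpha(t)\,\rho^i_\alpha(q(t)),\qquad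 \frac{\mathrm{d}s}{\mathrm{d}t}=L(\widetilde c(t)),$$ for $i=1,\dots,n$ and $\alpha=1,\dots,m$, where $\rho^i_\alpha$ and $\mathcal{C}^\gamma_{\alpha\beta}$ are the structure functions of $E$ with respect to the coordinates $(q^i)$ and the local basis $\{e_\alpha\}$.
   Context: All manifolds and maps are $C^\infty$; repeated indices are summed. Lie algebroids. A Lie algebroid $(E,[\![\cdot,\cdot]\!],\rho)$ over $Q$ is a vector bundle $\tau:E\to Q$ with a Lie bracket $[\![\cdot,\cdot]\!]$ on its sections $Sec(E)$ and a vector bundle map $\rho:E\to TQ$ (anchor) such that $[\![\sigma_1,f\sigma_2]\!]=f[\![\sigma_1,\sigma_2]\!]+(\rho(\sigma_1)f)\sigma_2$ for $f\in C^\infty(Q)$. In local coordinates $(q^i)$ on $Q$ and a local basis $\{e_\alpha\}$ of $Sec(E)$, the structure functions are defined by $\rho(e_\alpha)=\rho^i_\alpha\,\partial/\partial q^i$, $[\![e_\alpha,e_\beta]\!]=\mathcal{C}^\gamma_{\alpha\beta}e_\gamma$. The exterior differential $\mathrm{d}^E:Sec(\bigwedge^kE^* )\to Sec(\bigwedge^{k+1}E^* )$ is $\mathrm{d}^E\mu(\sigma_1,\dots,\sigma_{k+1})=\sum_i(-1)^{i+1}\rho(\sigma_i)\mu(\dots,\widehat{\sigma_i},\dots)+\sum_{i<j}(-1)^{i+j}\mu([\![\sigma_i,\sigma_j]\!],\dots,\widehat{\sigma_i},\dots,\widehat{\sigma_j},\dots)$. A contact section on a Lie algebroid $A$ of rank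 $2k+1$ is a section $\eta$ of $A^*$ with $\eta\wedge(\mathrm{d}^A\eta)^k\neq0$ everywhere; its Reeb section $\mathcal{R}\in Sec(A)$ is the unique section with $\imath_{\mathcal{R}}\mathrm{d}^A\eta=0$, $\imath_{\mathcal{R}}\eta=1$. Prolongation. Let $\pi:E\times\mathbb{R}\to Q$, $\pi(b_q,s)=q$. $\mathcal{T}^E(E\times\mathbb{R})$ is the vector bundle $\widetilde\tau_{E\times\mathbb{R}}:\mathcal{T}^E(E\times\mathbb{R})\to E\times\mathbb{R}$ whose fibre over $(b_q,s)$ is $\{(a_q,v)\in E_q\times T_{(b_q,s)}(E\times\mathbb{R}):\rho(a_q)=T\pi(v)\}$. Let $(q^i,y^\alpha,s)$ be the coordinates on $E\times\mathbb{R}$ induced by $(q^i)$ and $\{e_\alpha\}$. A local basis of sections is $\mathcal{X}_\alpha(b_q,s)=(e_\alpha(q),\rho^i_\alpha(q)\,\partial/\partial q^i|_{(b_q,s)})$, $\mathcal{V}_\alpha(b_q,s)=(0_q,\partial/\partial y^\alpha|_{(b_q,s)})$, $\mathcal{V}_s(b_q,s)=(0_q,\partial/\partial s|_{(b_q,s)})$, with dual basis $\mathcal{X}^\alpha,\mathcal{V}^\alpha,\mathcal{V}^s$. It is a Lie algebroid over $E\times\mathbb{R}$ with anchor $\rho^\pi(a_q,v)=v$ and bracket determined by $[\![\mathcal{X}_\alpha,\mathcal{X}_\beta]\!]^\pi=\mathcal{C}^\gamma_{\alpha\beta}\mathcal{X}_\gamma$, all other brackets of basis sections being zero. Write $\mathrm{d}$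 for its exterior differential; $\mathcal{V}^s=\mathrm{d}s$. Canonical objects. The vertical lift of $a_q$ to $(b_q,s)$ is the vector $(a_q)^V_{(b_q,s)}\in T_{(b_q,s)}(E\times\mathbb{R})$ with $(a_q)^V_{(b_q,s)}f=\frac{d}{dt}|_{t=0}f(b_q+ta_q,s)$. The vertical endomorphism is $S(a_q,v_{(b_q,s)})=(0_q,(a_q)^V_{(b_q,s)})$ (locally $S=\mathcal{V}_\alpha\otimes\mathcal{X}^\alpha$), and the Liouville section is $\Delta(b_q,s)=(0_q,(b_q)^V_{(b_q,s)})$ (locally $\Delta=y^\alpha\mathcal{V}_\alpha$). Lagrangian objects. For $L:E\times\mathbb{R}\to\mathbb{R}$: $\Theta_L(b_q,s)(a_q,v)=[\rho^\pi(S(a_q,v))]L$, $\eta_L=\mathcal{V}^s-\Theta_L$ (locally $\eta_L=\mathcal{V}^s-\frac{\partial L}{\partial y^\alpha}\mathcal{X}^\alpha$), and $E_L=\rho^\pi(\Delta)L-L$ (locally $E_L=y^\alpha\frac{\partial L}{\partial y^\alpha}-L$). $L$ is regular if the matrix $(\partial^2L/\partial y^\alpha\partial y^\beta)$ is non-singular everywhere; then $\eta_L$ is a contact section of $\mathcal{T}^E(E\times\mathbb{R})$, and $\mathcal{R}_L$ denotes its Reeb section. An integral curve of a section $\xi$ of $\mathcal{T}^E(E\times\mathbb{R})$ is an integral curve of the vector field $\rho^\pi(\xi)$ on $E\times\mathbb{R}$. *)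

(* Defs.v *)
From HB Require Import structures.
From mathcomp Require Import all_boot all_order all_algebra.
From mathcomp Require Import all_classical all_reals all_analysis.

Set Implicit Arguments.
Unset Strict Implicit.
Unset Printing Implicit Defensive.

Import Order.TTheory GRing.Theory Num.Theory.
Import numFieldNormedType.Exports.

Local Open Scope classical_set_scope.
Local Open Scope ring_scope.

(** * Smooth functions, charts, tangent vectors *)

Section Charts.
Context {R : realType}.

(** The basis vector e_i of R^k. *)
Definition evec (k : nat) (i : 'I_k) : 'rV[R]_k := delta_mx 0 i.

(** [f] is of class C^j on the open set [O]: the partial derivatives of order
    at most [j] exist and are continuous. *)
Fixpoint Ck (k j : nat) (O : set 'rV[R]_k) (f : 'rV[R]_k -> R) : Prop :=
  (forall x, O x -> {for x, continuous f}) /\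
  match j with
  | 0%N => True
  | j'.+1 => forall i : 'I_k,
      (forall x, O x -> derivable f x (evec i)) /\
      Ck j' O (fun x => 'D_(evec i) f x)
  end.

Definition smooth_on (k : nat) (O : set 'rV[R]_k) (f : 'rV[R]_k -> R) : Prop :=
  forall j, Ck j O f.

(** [cmap] is only meaningful on [cdom], and [cinv] on [cmap @` cdom]. *)
Record chart (T : Type) (k : nat) := Chart {
  cdom : set T;
  cmap : T -> 'rV[R]_k;
  cinv : 'rV[R]_k -> T }.

Section Atlas.
Context {T : Type} {k : nat}.
Variable A : set (chart T k).

Definition near_pt (p : T) (P : set T) : Prop :=
  exists (c : chart T k) (O : set 'rV[R]_k),
    [/\ A c, cdom c p, open_nbhs (cmap c p) O,
        O `<=` cmap c @` cdom c & forall x, O x -> P (cinv c x)].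

(** [f] is C^oo on a neighbourhood of [p]. *)
Definition smooth_near (p : T) (f : T -> R) : Prop :=
  exists (c : chart T k) (O : set 'rV[R]_k),
    [/\ A c, cdom c p, open_nbhs (cmap c p) O,
        O `<=` cmap c @` cdom c & smooth_on O (f \o cinv c)].

Definition smooth_fun (f : T -> R) : Prop := forall p, smooth_near p f.

(** The tangent vector at [p] with components [w] in the chart [c], as a
    derivation of the functions that are smooth near [p].  The value 0 on all
    other functions is a normalisation which makes tangent vectors equal as
    soon as they agree on functions smooth near [p]. *)
Definition coord_vec (c : chart T k) (p : T) (w : 'rV[R]_k) : (T -> R) -> R :=
  fun f => if `[< smooth_near p f >]
           then 'D_w (f \o cinv c) (cmap c p) else 0.

Definition tangent (p : T) (v : (T -> R) -> R) : Prop :=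
  exists c w, [/\ A c, cdom c p & v = coord_vec c p w].

End Atlas.

Definition pder (T : Type) (k : nat) (c : chart T k) (i : 'I_k) (f : T -> R) :
  T -> R := fun p => 'D_(evec i) (f \o cinv c) (cmap c p).

End Charts.
Arguments chart : clear implicits.

(** * Manifolds and vector bundles *)

Section Manifolds.
Context {R : realType}.

Record is_chart (Q : topologicalType) (n : nat) (c : chart R Q n) : Prop := {
  chart_dom_open : open (cdom c);
  chart_img_open : open (cmap c @` cdom c);
  chart_mapK : forall q, cdom c q -> cinv c (cmap c q) = q;
  chart_map_cont : forall q, cdom c q -> {for q, continuous (cmap c)};
  chart_inv_cont : forall x, (cmap c @` cdom c) x ->
    {for x, continuous (cinv c)} }.

Definition chart_compat (Q : Type) (n : nat) (c c' : chart R Q n) : Prop :=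
  forall i : 'I_n, smooth_on (cmap c @` (cdom c `&` cdom c'))
    (fun x => cmap c' (cinv c x) 0 i).

End Manifolds.

Record manifold (R : realType) (n : nat) := Manifold {
  carrier :> topologicalType;
  atlas : set (chart R carrier n);
  mfd_hausdorff : hausdorff_space carrier;
  mfd_countable : @second_countable carrier;
  atlas_chart : forall c, atlas c -> is_chart c;
  atlas_cover : forall q, exists2 c, atlas c & cdom c q;
  atlas_compat : forall c c', atlas c -> atlas c' -> chart_compat c c';
  atlas_max : forall c, is_chart c ->
    (forall c', atlas c' -> chart_compat c c' /\ chart_compat c' c) ->
    atlas c }.
Arguments atlas {R n} Q : rename.

Section Bundles.
Context {R : realType} {n : nat}.
Variable Q : manifold R n.

Section Frames.
Context {m : nat} (E : Q -> lmodType R).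

(** A local basis e_0, ..., e_(m-1) over [fdom]; [fco q] gives the linear
    coordinates y^alpha on the fibre over [q]. *)
Record frame := Frame {
  fdom : set Q;
  fvec : forall q, 'I_m -> E q;
  fco : forall q, E q -> 'rV[R]_m }.

Record is_frame (e : frame) : Prop := {
  frame_dom_open : open (fdom e);
  frame_coK : forall q, fdom e q -> forall y : 'rV[R]_m,
    fco e (\sum_a y 0 a *: fvec e q a) = y;
  frame_vecK : forall q, fdom e q -> forall b : E q,
    \sum_a fco e b 0 a *: fvec e q a = b }.

Definition section_smooth_near (F : set frame) (q : Q)
    (s : forall q, E q) : Prop :=
  forall e, F e -> fdom e q -> forall a : 'I_m,
    smooth_near (atlas Q) q (fun q' => fco e (s q') 0 a).

End Frames.
Arguments frame m E : clear implicits.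

(** A vector bundle of rank [m], presented by its fibres and by the family of
    all its smooth local bases (equivalently, its maximal bundle atlas). *)
Record vbundle (m : nat) := Vbundle {
  fibre :> Q -> lmodType R;
  frames : set (frame m fibre);
  frames_frame : forall e, frames e -> is_frame e;
  frames_cover : forall q, exists2 e, frames e & fdom e q;
  frames_smooth : forall e, frames e -> forall q, fdom e q ->
    forall a, section_smooth_near frames q (fun q' => fvec e q' a);
  frames_max : forall e, is_frame e ->
    (forall q, fdom e q ->
      forall a, section_smooth_near frames q (fun q' => fvec e q' a)) ->
    frames e }.
Arguments frames {m} E : rename.

Definition smooth_section (m : nat) (E : vbundle m) (s : forall q, E q) : Prop :=
  forall q, section_smooth_near (frames E) q s.

End Bundles.
Arguments frame {R n Q} m E.
Arguments frames {R n Q m} E : rename.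

(** * Lie algebroids *)

(** [br] is a Lie bracket on the sections in [sec] which satisfies the Leibniz
    rule for the anchor [rho]; [rho p a f] is the derivative of [f] along the
    image of [a] under the anchor. *)
Record algebroid_bracket (R : realType) (T : Type) (F : T -> lmodType R)
    (fn : set (T -> R)) (sec : set (forall p, F p))
    (rho : forall p, F p -> (T -> R) -> R)
    (br : (forall p, F p) -> (forall p, F p) -> forall p, F p) : Prop := {
  br_closed : forall s t, sec s -> sec t -> sec (br s t);
  br_linear : forall (k : R) s s' t, sec s -> sec s' -> sec t -> forall p,
    br (fun p => k *: s p + s' p) t p = k *: br s t p + br s' t p;
  br_anti : forall s t, sec s -> sec t -> forall p, br s t p = - br t s p;
  br_jacobi : forall s t u, sec s -> sec t -> sec u -> forall p,
    br s (br t u) p + br t (br u s) p + br u (br s t) p = 0;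
  br_leibniz : forall s t f, sec s -> sec t -> fn f -> forall p,
    br s (fun p => f p *: t p) p
    = f p *: br s t p + rho p (s p) f *: t p }.

Record lie_algebroid (R : realType) (n : nat) (Q : manifold R n) (m : nat)
    (E : vbundle Q m) := LieAlgebroid {
  anchor : forall q, E q -> (Q -> R) -> R;
  bracket : (forall q, E q) -> (forall q, E q) -> forall q, E q;
  anchor_tangent : forall q a, tangent (atlas Q) q (@anchor q a);
  anchor_linear : forall q, linear (@anchor q);
  anchor_smooth : forall c e, atlas Q c -> frames E e ->
    forall q, cdom c q -> fdom e q -> forall a (i : 'I_n),
    smooth_near (atlas Q) q
      (fun q' => anchor (fvec e q' a) (fun x => cmap c x 0 i));
  bracketP : algebroid_bracket (smooth_fun (atlas Q)) (@smooth_section R n Q m E)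
    anchor bracket }.

Section Algebroid.
Context {R : realType} {n m : nat} {Q : manifold R n} {E : vbundle Q m}.
Variable A : lie_algebroid E.

(** rho^i_a(q), for the chart [c] and the local basis [e]. *)
Definition anchor_coef (c : chart R Q n) (e : frame m E) (i : 'I_n) (a : 'I_m)
    (q : Q) : R :=
  anchor A (fvec e q a) (fun x => cmap c x 0 i).

(** [C g a b] is the structure function C^g_(a b) of the local basis [e].  The
    bracket being defined on global sections, the bracket of [e_a] and [e_b] at
    [q] is that of any two global sections extending them near [q]. *)
Definition structure_functions (e : frame m E)
    (C : 'I_m -> 'I_m -> 'I_m -> Q -> R) : Prop :=
  forall q, fdom e q -> forall (a b : 'I_m) (s t : forall q, E q),
    smooth_section s -> smooth_section t ->
    (\forall q' \near q, s q' = fvec e q' a) ->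
    (\forall q' \near q, t q' = fvec e q' b) ->
    bracket A s t q = \sum_g C g a b q *: fvec e q g.

End Algebroid.

(** * The manifold E x R and the prolongation of E *)

Section Total.
Context {R : realType} {n m : nat} {Q : manifold R n}.
Variable E : vbundle Q m.

Definition ExR : Type := ({q : Q & E q} * R)%type.

Definition pt (q : Q) (b : E q) (s : R) : ExR := (existT _ q b, s).
Definition base (p : ExR) : Q := projT1 p.1.
Definition vel (p : ExR) : E (base p) := projT2 p.1.

(** Positions of q^i, y^a and s in the coordinates (q^i, y^a, s). *)
Definition iq (i : 'I_n) : 'I_(n + m + 1) := lshift 1 (lshift m i).
Definition iy (a : 'I_m) : 'I_(n + m + 1) := lshift 1 (rshift n a).
Definition i_s : 'I_(n + m + 1) := rshift (n + m) ord0.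

Definition ycoord (e : frame m E) (a : 'I_m) : ExR -> R :=
  fun p => fco e (vel p) 0 a.

Definition scoord : ExR -> R := fun p => p.2.

(** The coordinates (q^i, y^a, s) induced by a chart and a local basis. *)
Definition adapted (c : chart R Q n) (e : frame m E) :
    chart R ExR (n + m + 1) :=
  {| cdom := [set p | cdom c (base p) /\ fdom e (base p)];
     cmap := fun p => row_mx (row_mx (cmap c (base p)) (fco e (vel p)))
                             (scoord p)%:M;
     cinv := fun x => let q := cinv c (lsubmx (lsubmx x)) in
       pt (\sum_a rsubmx (lsubmx x) 0 a *: fvec e q a) (rsubmx x 0 0) |}.

Definition total_atlas : set (chart R ExR (n + m + 1)) :=
  [set c' | exists c e, [/\ atlas Q c, frames E e & c' = adapted c e]].

(** The fibre over [p] of the prolongation is the set of those elements of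
    [prol p] which satisfy [prol_fibre]. *)
Definition prol (p : ExR) : lmodType R :=
  (E (base p) * ((ExR -> R) -> R))%type.

Definition psection := forall p : ExR, prol p.

Definition prol_fibre (A : lie_algebroid E) (p : ExR) (z : prol p) : Prop :=
  tangent total_atlas p z.2 /\
  forall f, smooth_near (atlas Q) (base p) f ->
    anchor A z.1 f = z.2 (f \o base).

(** The anchor rho^pi. *)
Definition panchor (p : ExR) (z : prol p) : (ExR -> R) -> R := z.2.

(** Local basis of the prolongation. *)
Inductive pindex := PX of 'I_m | PV of 'I_m | PS.

Definition pbasis (A : lie_algebroid E) (c : chart R Q n) (e : frame m E)
    (k : pindex) (p : ExR) : prol p :=
  match k with
  | PX a => (fvec e (base p) a, coord_vec total_atlas (adapted c e) p
              (\sum_i anchor_coef A c e i a (base p) *: evec (iq i)))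
  | PV a => (0, coord_vec total_atlas (adapted c e) p (evec (iy a)))
  | PS => (0, coord_vec total_atlas (adapted c e) p (evec i_s))
  end.

(** Dual basis X^a, V^a, V^s. *)
Definition pdual (e : frame m E) (k : pindex) (p : ExR) (z : prol p) : R :=
  match k with
  | PX a => fco e z.1 0 a
  | PV a => z.2 (ycoord e a)
  | PS => z.2 scoord
  end.

Definition smooth_psection (A : lie_algebroid E) (Z : psection) : Prop :=
  (forall p, prol_fibre A (Z p)) /\
  forall e, frames E e -> forall p, fdom e (base p) -> forall k,
    smooth_near total_atlas p (fun p' => pdual e k (Z p')).

(** The Lie algebroid structure of the prolongation. *)
Record prolongation (A : lie_algebroid E) := Prolongation {
  pbracket : psection -> psection -> psection;
  pbracketP : algebroid_bracket (smooth_fun total_atlas) (smooth_psection A)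
    panchor pbracket;
  pbracket_basis : forall c e C, atlas Q c -> frames E e ->
    structure_functions A e C ->
    forall p, cdom (adapted c e) p -> forall (k l : pindex) (Z W : psection),
    smooth_psection A Z -> smooth_psection A W ->
    near_pt total_atlas p (fun p' => Z p' = pbasis A c e k p') ->
    near_pt total_atlas p (fun p' => W p' = pbasis A c e l p') ->
    pbracket Z W p =
      match k, l with
      | PX a, PX b => \sum_g C g a b (base p) *: pbasis A c e (PX g) p
      | _, _ => 0
      end }.

(** * Canonical and Lagrangian objects *)

Definition vlift (p : ExR) (a : E (base p)) : (ExR -> R) -> R :=
  fun f => if `[< smooth_near total_atlas p f >]
           then derive1 (fun t : R => f (pt (vel p + t *: a) p.2)) 0 else 0.

Definition vertical_endo (p : ExR) (z : prol p) : prol p := (0, vlift z.1).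

Definition liouville : psection := fun p => (0, vlift (vel p)).

Definition Theta (L : ExR -> R) (p : ExR) (z : prol p) : R :=
  panchor (vertical_endo z) L.

(** eta_L = V^s - Theta_L, with V^s = ds. *)
Definition eta (L : ExR -> R) (p : ExR) (z : prol p) : R :=
  panchor z scoord - Theta L z.

Definition energy (L : ExR -> R) (p : ExR) : R :=
  panchor (liouville p) L - L p.

(** The matrix is taken in every adapted coordinate system. *)
Definition regular (L : ExR -> R) : Prop :=
  forall c e, atlas Q c -> frames E e ->
  forall p, cdom (adapted c e) p ->
    (\matrix_(a < m, b < m)
       pder (adapted c e) (iy a) (pder (adapted c e) (iy b) L) p) \in unitmx.

(** Exterior differentials of functions and of 1-sections on the prolongation. *)
Definition pd0 (f : ExR -> R) (Z : psection) : ExR -> R :=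
  fun p => panchor (Z p) f.

Definition pd1 (A : lie_algebroid E) (P : prolongation A)
    (mu : forall p, prol p -> R) (Z W : psection) : ExR -> R :=
  fun p => panchor (Z p) (fun p' => mu p' (W p'))
         - panchor (W p) (fun p' => mu p' (Z p'))
         - mu p (pbracket P Z W p).

Definition is_reeb (A : lie_algebroid E) (P : prolongation A)
    (L : ExR -> R) (Z : psection) : Prop :=
  [/\ smooth_psection A Z,
      forall W, smooth_psection A W -> forall p, pd1 P (eta L) Z W p = 0
    & forall p, eta L (Z p) = 1].

Definition lagrangian_section (A : lie_algebroid E) (P : prolongation A)
    (L : ExR -> R) (Reeb G : psection) : Prop :=
  [/\ smooth_psection A G,
      forall p, eta L (G p) = - energy L p
    & forall W, smooth_psection A W -> forall p,
        pd1 P (eta L) G W p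
        = pd0 (energy L) W p - pd0 (energy L) Reeb p * eta L (W p)].

Definition sode (G : psection) : Prop :=
  forall p, vertical_endo (G p) = liouville p.

(** The velocity of the curve at [t] is rho^pi (G (cv t)). *)
Definition integral_curve (G : psection) (I : set R) (cv : R -> ExR) : Prop :=
  forall t, I t -> forall f, smooth_near total_atlas (cv t) f ->
    is_derive t 1 (f \o cv) (panchor (G (cv t)) f).

(** The Herglotz equations for [cv] at time [t], in the coordinates given by
    the chart [c] and the local basis [e] with structure functions [C]. *)
Definition herglotz_at (A : lie_algebroid E) (L : ExR -> R)
    (c : chart R Q n) (e : frame m E) (C : 'I_m -> 'I_m -> 'I_m -> Q -> R)
    (cv : R -> ExR) (t : R) : Prop :=
  let dL k := pder (adapted c e) k L in
  let p := cv t in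
  let q := base p in
  [/\ forall a : 'I_m, is_derive t 1 (fun t' => dL (iy a) (cv t'))
        (\sum_i anchor_coef A c e i a q * dL (iq i) p
         - \sum_b \sum_g ycoord e b p * C g a b q * dL (iy g) p
         + dL (iy a) p * dL i_s p),
      forall i : 'I_n, is_derive t 1 (fun t' => cmap c (base (cv t')) 0 i)
        (\sum_a ycoord e a p * anchor_coef A c e i a q)
    & is_derive t 1 (fun t' => scoord (cv t')) (L p)].

End Total.
Arguments total_atlas {R n m Q} E _.

(* Main.v *)
Require Import Defs.
From HB Require Import structures.
From mathcomp Require Import all_boot all_order all_algebra.
From mathcomp Require Import all_classical all_reals all_analysis.
From mathcomp Require Import perm ring lra.
Import Order.TTheory GRing.Theory Num.Theory.
Import numFieldNormedType.Exports.
Local Open Scope classical_set_scope.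
Local Open Scope ring_scope.

(** The equations that define the Lagrangian section are pointwise linear in its
    value, and in an adapted chart they can be solved by hand.  With
    [eta = V^s - L_a X^a], where [L_a = dL/dy^a], and
    [Gamma = G^a X_a + g^a V_a + s V_s], testing the equation for
    [i_Gamma d eta] against the basis sections gives

    - against [V_b]: [G^a (dL_a/dy^b) = y^a (dL_a/dy^b)], so [G^a = y^a] by
      regularity, which is the SODE property;
    - with the equation [i_Gamma eta = - E_L]: [s = L];
    - against [X_b]: a linear system with matrix the Hessian of [L] for the
      accelerations [g^a], which, read along an integral curve, is the Herglotz
      equation because [Gamma (L_b)] is the time derivative of [L_b];
    - against [V_s]: nothing new, since the Reeb section satisfies
      [R_L (E_L) = - dL/ds] ([reeb_energy]).

    This is [lagrangian_coordsP].  Uniqueness follows at once.  For existence the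
    system is solved smoothly over a chart ([local_solution]) and the local
    solutions are glued ([lagrangian_section_exists]): they agree on overlaps by
    uniqueness, because the equations themselves do not refer to a chart.

    What has to be justified is the passage to coordinates, because brackets and
    exterior differentials are given on global sections.  The exterior
    differential of [eta] is linear over smooth functions in both arguments
    ([pd1_anti], [pd1Z]), and [Q] carries smooth cut-off functions
    ([cutoff_exists]); multiplying a section twice by a cut-off expresses it
    globally through cut-off basis sections ([pd1_expand]), on which the bracket
    is known ([pd1_basis]).  It suffices to cut off in the base, since the basis
    sections are defined over entire fibres of [E x R].

    The analytic foundation is that functions with continuous partial derivatives
    are differentiable ([differentiable_partials]), which gives the chain rule
    and the independence of smoothness and of tangent vectors from the chart
    ([smooth_nearP], [tangentE]). *)

Set Implicit Arguments.
Unset Strict Implicit.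
Unset Printing Implicit Defensive.

Local Notation eta := Defs.eta.

(** * Differential calculus on R^k *)

Section Calculus.
Context {R : realType}.

Section Line.
Context {V W : normedModType R}.
Variables (f : V -> W) (x v : V) (s : R).

Let quotE : (fun h : R => h^-1 *: (f (h *: v + (s *: v + x)) - f (s *: v + x)))
  = (fun h : R => h^-1 *: (f ((h *: 1 + s) *: v + x) - f (s *: v + x))).
Proof. by apply/funext => h; rewrite scalerDl addrA [h *: 1]mulr1. Qed.

Lemma derive_line : 'D_1 (fun t : R => f (t *: v + x)) s = 'D_v f (s *: v + x).
Proof. by rewrite /derive -quotE. Qed.

Lemma is_derive_line : derivable f (s *: v + x) v ->
  is_derive s 1 (fun t : R => f (t *: v + x)) ('D_v f (s *: v + x)).
Proof.
move=> df; apply: DeriveDef; last exact: derive_line.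
by rewrite /derivable -quotE.
Qed.

End Line.

Lemma is_derive_mulr (c t : R) : is_derive t 1 (fun s : R => s * c) c.
Proof.
have -> : (fun s : R => s * c) = c *: (@id R).
  by apply/funext => s; rewrite mulrC.
by apply: is_derive_eq; rewrite [_ *: _]mulr1.
Qed.

Lemma rV_norm_le (k : nat) (u v : 'rV[R]_k) :
  (forall i, `|u 0 i| <= `|v 0 i|) -> `|u| <= `|v|.
Proof.
move=> uv; rewrite /Num.Def.normr /= !mx_normrE; apply: le_bigmax2 => -[i j] _ /=.
by rewrite ord1.
Qed.

Lemma rV_coord_norm (k : nat) (v : 'rV[R]_k) i : `|v 0 i| <= `|v|.
Proof.
rewrite [leRHS]/Num.Def.normr /= mx_normrE.
exact: (le_bigmax _ (fun ij : 'I_1 * 'I_k => `|v ij.1 ij.2|) (0, i)).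
Qed.

Lemma row_sum_evec (k : nat) (v : 'rV[R]_k) : v = \sum_i v 0 i *: evec i.
Proof. by rewrite [LHS]row_sum_delta. Qed.

Lemma differentiable_est (V W : normedModType R) (f : V -> W)
    (df : {linear V -> W}) (x : V) : continuous df ->
  (forall e, 0 < e ->
     \forall h \near 0, `|f (h + x) - f x - df h| <= e * `|h|) ->
  differentiable f x.
Proof.
move=> dfc dfe.
have est : f \o shift x = cst (f x) + df +o_ 0 id.
  apply/eqaddoP => e e0; apply: filterS (dfe _ e0) => h.
  by rewrite /= !fctE /= opprD addrA.
by apply/diff_locallyP; rewrite (diff_unique dfc est); split.
Qed.

(** The increment of [f] is telescoped along the coordinate axes and the mean
    value theorem is applied on each axis. *)
Lemma differentiable_partials (k : nat) (O : set 'rV[R]_k) (f : 'rV[R]_k -> R)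
    (x : 'rV[R]_k) :
  open O -> O x ->
  (forall i y, O y -> derivable f y (evec i)) ->
  (forall i, {for x, continuous (fun y => 'D_(evec i) f y)}) ->
  differentiable f x.
Proof.
move=> oO Ox fd fc.
pose df (h : 'rV[R]_k) : R := \sum_i h 0 i * 'D_(evec i) f x.
have dflin : linear df.
  move=> a u v; rewrite /df scaler_sumr -big_split /=; apply: eq_bigr => i _.
  by rewrite !mxE mulrDl -mulrA.
pose dfL : {linear 'rV[R]_k -> R} :=
  HB.pack df (GRing.isLinear.Build _ _ _ _ df dflin).
have dfc : continuous (dfL : 'rV[R]_k -> R).
  change (continuous (fun h : 'rV[R]_k => \sum_i h 0 i * 'D_(evec i) f x)).
  have cc i : continuous (fun h : 'rV[R]_k => h 0 i * 'D_(evec i) f x).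
    move=> y; have h1 := @coord_continuous R 1 k 0 i y.
    exact: (cvgM h1 (cvg_cst _)).
  exact: (@continuous_big R 'I_k (@GRing.add R) 0 xpredT (@add_continuous R)
    'rV[R]_k (index_enum _) _ (fun i _ => cc i)).
apply: (differentiable_est dfc) => e e0.
  have e'0 : 0 < e / k.+1%:R by rewrite divr_gt0.
  have : \forall y \near x, O y /\ forall i : 'I_k,
      `|'D_(evec i) f x - 'D_(evec i) f y| <= e / k.+1%:R.
    have nO : nbhs x O by exact: open_nbhs_nbhs.
    have nD : nbhs x (fun y => forall i : 'I_k,
      `|'D_(evec i) f x - 'D_(evec i) f y| <= e / k.+1%:R).
      apply: (@filter_forall _ _ _ (nbhs x) (nbhs_filter x)) => i.
      by have /cvgrPdist_le := fc i; exact.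
    exact: filterI nO nD.
  move=> /nbhs_ballP[d /= d0 H].
  near=> h.
  have hd : `|h| < d.
    near: h; apply/nbhs_ballP; exists d => //= z.
    by rewrite -ball_normE /= sub0r normrN.
  pose hh (j : nat) : 'rV[R]_k := \row_i (if (i < j)%N then h 0 i else 0).
  have hhS (j : 'I_k) : hh j.+1 = h 0 j *: evec j + hh j.
    apply/rowP => i; rewrite !mxE /=.
    have [->|ij] := eqVneq i j; first by rewrite ltnSn ltnn addr0 mulr1.
    rewrite mulr0 add0r ltnS leq_eqVlt.
    by have /negPf-> : (i : nat) != j by [].
  have tel : f (h + x) - f x = \sum_(j < k) (f (hh j.+1 + x) - f (hh j + x)).
    rewrite -(big_mkord xpredT (fun j => f (hh j.+1 + x) - f (hh j + x))).
    rewrite telescope_sumr //; congr (f (_ + x) - f _).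
      by apply/rowP => i; rewrite mxE ltn_ord.
    by rewrite -[LHS]add0r; congr (_ + _); apply/rowP => i; rewrite !mxE.
  have step (j : 'I_k) : `|f (hh j.+1 + x) - f (hh j + x)
        - h 0 j * 'D_(evec j) f x| <= e / k.+1%:R * `|h|.
    have inb (t : R) : t \in `[0, 1]%R ->
        ball x d ((t * h 0 j) *: evec j + (hh j + x)).
      rewrite in_itv /= => /andP[t0 t1]; rewrite -ball_normE /= distrC addrA addrK.
      apply: le_lt_trans hd; apply: rV_norm_le => i; rewrite !mxE /=.
      have [->|ij] := eqVneq i j.
        by rewrite ltnn addr0 mulr1 normrM ger0_norm // ler_piMl.
      by rewrite mulr0 add0r; case: ifP => // _; rewrite normr0.
    pose phi (t : R) := f (t *: (h 0 j *: evec j) + (hh j + x)).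
    have dphi (t : R) : t \in `[0, 1]%R ->
        is_derive t 1 phi (h 0 j * 'D_(evec j) f ((t * h 0 j) *: evec j + (hh j + x))).
      move=> /inb/H [Oy _].
      have -> : phi = (fun s => f (s *: evec j + (hh j + x))) \o (fun t => t * h 0 j).
        by apply/funext => s; rewrite /phi /= scalerA.
      rewrite mulrC; apply: is_derive1_comp; first exact/is_derive_line/fd.
      exact: is_derive_mulr.
    pose D (t : R) := h 0 j * 'D_(evec j) f ((t * h 0 j) *: evec j + (hh j + x)).
    have [c c01] : exists2 c, c \in `[0, 1]%R & phi 1 - phi 0 = D c * (1 - 0).
      have dphi' (t : R) : t \in `]0, 1[%R -> is_derive t 1 phi (D t).
        by move=> /subset_itv_oo_cc; exact: dphi.
      have cphi : {within `[0, 1], continuous phi}.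
        by apply: derivable_within_continuous => t /dphi [].
      exact: MVT_segment ler01 dphi' cphi.
    rewrite /phi scale1r scale0r add0r subr0 mulr1 addrA -hhS => ->.
    rewrite -mulrBr normrM mulrC; apply: ler_pM => //; last exact: rV_coord_norm.
    by rewrite distrC; have [_] := H _ (inb _ c01); apply.
  have -> : f (h + x) - f x - dfL h =
     \sum_(j < k) (f (hh j.+1 + x) - f (hh j + x) - h 0 j * 'D_(evec j) f x).
    by rewrite sumrB -tel.
  apply: le_trans (ler_norm_sum _ _ _) _.
  apply: le_trans (ler_sum _ (fun j _ => step j)) _.
  rewrite sumr_const card_ord -[leLHS]mulr_natl mulrA ler_wpM2r //.
  rewrite mulrCA; apply: ler_piMr; first exact: ltW.
  by rewrite ler_pdivrMr // mul1r ler_nat.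
Unshelve. all: by end_near. Qed.

Lemma derive_partials (k : nat) (f : 'rV[R]_k -> R) (x v : 'rV[R]_k) :
  differentiable f x -> 'D_v f x = \sum_i v 0 i * 'D_(evec i) f x.
Proof.
move=> df; rewrite deriveE // {1}[v]row_sum_evec linear_sum.
by apply: eq_bigr => i _; rewrite linearZ -deriveE.
Qed.

(** Restricting to the line through [x] with direction [v] reduces the chain
    rule to curves, where being derivable is being differentiable. *)
Lemma is_derive_chain (k : nat) (V : normedModType R) (f : 'rV[R]_k -> R)
    (g : V -> 'rV[R]_k) (x v : V) :
  differentiable f (g x) ->
  (forall i, derivable (fun y => g y 0 i) x v) ->
  is_derive x v (fun y => f (g y))
    (\sum_i 'D_v (fun y => g y 0 i) x * 'D_(evec i) f (g x)).
Proof.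
move=> df dg.
have dgx : derivable g x v by apply/derivable_mxP => i j; rewrite ord1.
pose c (t : R) := g (t *: v + x).
have c0 : c 0 = g x by rewrite /c scale0r add0r.
have dc : differentiable c 0.
  exact: (iffLR (derivable1_diffP _ _) (iffLR (derivable1P g x v) dgx)).
have dfc : differentiable (f \o c) 0.
  by apply: differentiable_comp; [exact: dc|rewrite c0].
have Dfg : derivable (fun y => f (g y)) x v.
  apply: (iffRL (derivable1P (fun y => f (g y)) x v)).
  exact: (iffRL (derivable1_diffP _ _) dfc).
apply: DeriveDef => //.
have lineE (W : normedModType R) (h : V -> W) :
    'D_v h x = 'D_1 (fun t : R => h (t *: v + x)) 0.
  by rewrite derive_line scale0r add0r.
rewrite (lineE R); change ('D_1 (f \o c) 0 =
  \sum_i 'D_v (fun y => g y 0 i) x * 'D_(evec i) f (g x)).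
have dfc0 : differentiable f (c 0) by rewrite c0.
rewrite (deriveE _ dfc) (diff_comp dc dfc0) /=.
have -> : 'd c 0 1 = 'D_v g x by rewrite -(deriveE _ dc) (lineE 'rV[R]_k).
rewrite c0 -(deriveE _ df) (derive_partials _ df); apply: eq_bigr => i _.
by rewrite (derive_mx dgx) mxE.
Qed.

Lemma near_continuous (T U : topologicalType) (f g : T -> U) (x : T) :
  {near x, f =1 g} -> {for x, continuous f} -> {for x, continuous g}.
Proof.
move=> fg fc; rewrite /prop_for /continuous_at -(nbhs_singleton fg).
by apply: cvg_trans fc; exact: near_eq_cvg.
Qed.

Section CkTheory.
Context {k : nat}.
Implicit Types (O : set 'rV[R]_k) (f g : 'rV[R]_k -> R).

Lemma open_near O x (P : 'rV[R]_k -> Prop) : open O -> O x ->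
  (forall y, O y -> P y) -> \forall y \near x, P y.
Proof. by move=> oO Ox OP; apply: filterS OP _; exact: open_nbhs_nbhs. Qed.

Lemma Ck_continuous j O f x : Ck j O f -> O x -> {for x, continuous f}.
Proof. by case: j => [|j] [fc _]; exact: fc. Qed.

Lemma Ck_eq j O f g : open O -> (forall x, O x -> f x = g x) ->
  Ck j O f -> Ck j O g.
Proof.
move=> oO; elim: j f g => [|j IH] f g fg [fc fd];
  (split; first by move=> x Ox; apply: near_continuous (fc x Ox);
                   exact: open_near Ox fg) => //.
move=> i; have [fdi fCi] := fd i; split=> [x Ox|].
  by apply: near_eq_derivable (fdi x Ox); exact: open_near Ox fg.
apply: IH fCi => x Ox; apply: near_eq_derive; exact: open_near Ox fg.
Qed.

Lemma Ck_sub j O O' f : O' `<=` O -> Ck j O f -> Ck j O' f.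
Proof.
move=> OO'; elim: j f => [|j IH] f [fc fd]; split=> //;
  try by move=> x /OO'; exact: fc.
move=> i; have [fdi fCi] := fd i; split=> [x /OO'|]; first exact: fdi.
exact: IH.
Qed.

Lemma Ck_pred j O f : Ck j.+1 O f -> Ck j O f.
Proof.
elim: j f => [|j IH] f; first by case.
by move=> [fc fd]; split => // i; have [fdi /IH] := fd i.
Qed.

Lemma Ck_derivable j O f i x : Ck j.+1 O f -> O x -> derivable f x (evec i).
Proof. by move=> [_ /(_ i)[+ _]]; exact. Qed.

Lemma Ck_differentiable j O f x : open O -> O x -> Ck j.+1 O f ->
  differentiable f x.
Proof.
move=> oO Ox fC; apply: (differentiable_partials oO Ox) => i.
  by move=> y; exact: Ck_derivable fC.
by have [_ /(_ i)[_ /Ck_continuous]] := fC; exact.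
Qed.

Lemma Ck_cst j O (c : R) : Ck j O (fun=> c).
Proof.
elim: j c => [|j IH] c; split=> //; try by move=> x _; exact: cst_continuous.
move=> i; split=> [x _|]; first exact: derivable_cst.
have -> : (fun x => 'D_(evec i) (fun=> c) x) = (fun=> (0 : R)) => //.
by apply/funext => x; exact: derive_cst.
Qed.

Lemma CkD j O f g : open O -> Ck j O f -> Ck j O g ->
  Ck j O (fun x => f x + g x).
Proof.
move=> oO; elim: j f g => [|j IH] f g fC gC; split => //;
  try by move=> x Ox; exact:
    continuousD (Ck_continuous fC Ox) (Ck_continuous gC Ox).
move=> i; have [_ /(_ i)[fd fC']] := fC; have [_ /(_ i)[gd gC']] := gC.
split=> [x Ox|]; first by apply: derivableD; [exact: fd|exact: gd].
apply: Ck_eq oO _ (IH _ _ fC' gC') => x Ox.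
by rewrite deriveD //; [exact: fd|exact: gd].
Qed.

Lemma CkM j O f g : open O -> Ck j O f -> Ck j O g ->
  Ck j O (fun x => f x * g x).
Proof.
move=> oO; elim: j f g => [|j IH] f g fC gC; split => //;
  try by move=> x Ox; exact:
    continuousM (Ck_continuous fC Ox) (Ck_continuous gC Ox).
move=> i; have [_ /(_ i)[fd fC']] := fC; have [_ /(_ i)[gd gC']] := gC.
split=> [x Ox|]; first by apply: derivableM; [exact: fd|exact: gd].
apply: Ck_eq oO _ (CkD oO (IH _ _ (Ck_pred fC) gC') (IH _ _ (Ck_pred gC) fC')).
by move=> x Ox; rewrite deriveM //; [exact: fd|exact: gd].
Qed.

Lemma CkZ j O (c : R) f : open O -> Ck j O f -> Ck j O (fun x => c * f x).
Proof. by move=> oO; exact: CkM (Ck_cst _ _ _). Qed.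

Lemma CkV j O f : open O -> (forall x, O x -> f x != 0) -> Ck j O f ->
  Ck j O (fun x => (f x)^-1).
Proof.
move=> oO f0; elim: j f f0 => [|j IH] f f0 fC; split => //;
  try by move=> x Ox; exact: continuousV (f0 _ Ox) (Ck_continuous fC Ox).
move=> i; have [_ /(_ i)[fd fC']] := fC.
split=> [x Ox|]; first by apply: derivableV; [exact: f0|exact: fd].
have fC'' := IH _ f0 (Ck_pred fC).
apply: Ck_eq oO _ (CkZ (-1) oO (CkM oO (CkM oO fC'' fC'') fC')).
move=> x Ox; rewrite deriveV; [|exact: f0|exact: fd].
by rewrite -invfM expr2 mulN1r scaleNr.
Qed.

Lemma rV_continuous (T : topologicalType) (g : T -> 'rV[R]_k) x :
  (forall i, {for x, continuous (fun y => g y 0 i)}) -> {for x, continuous g}.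
Proof.
move=> gc; apply/cvgrPdist_le => e e0.
have : \forall y \near x, forall i, `|g x 0 i - g y 0 i| <= e.
  apply: (@filter_forall _ _ _ (nbhs x) (nbhs_filter x)) => i.
  by have /cvgrPdist_le := gc i; exact.
apply: filterS => y gy.
rewrite /Num.Def.normr /= mx_normrE; apply: bigmax_le; first exact: ltW.
by move=> -[i j] _ /=; rewrite ord1 !mxE.
Qed.

End CkTheory.

Lemma Ck_sum j k (O : set 'rV[R]_k) (I : Type) (r : seq I) (P : pred I)
    (F : I -> 'rV[R]_k -> R) : open O ->
  (forall i, P i -> Ck j O (F i)) ->
  Ck j O (fun x => \sum_(i <- r | P i) F i x).
Proof.
move=> oO FC; elim: r => [|i r IH].
  by apply: Ck_eq oO _ (Ck_cst j O 0) => x _; rewrite big_nil.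
case Pi : (P i).
  by apply: Ck_eq oO _ (CkD oO (FC i Pi) IH) => x _; rewrite big_cons Pi.
by apply: Ck_eq oO _ IH => x _; rewrite big_cons Pi.
Qed.

Lemma is_derive_coord k (x v : 'rV[R]_k) i :
  is_derive x v (fun y : 'rV[R]_k => y 0 i) (v 0 i).
Proof.
have d : derivable (fun y : 'rV[R]_k => y) x v by exact: derivable_id.
apply: DeriveDef; first by have /derivable_mxP := d; exact.
have := congr1 (fun w : 'rV[R]_k => w 0 i) (derive_mx d).
by rewrite derive_id mxE => ->.
Qed.

Lemma Ck_coord j k (O : set 'rV[R]_k) i : open O -> Ck j O (fun x => x 0 i).
Proof.
move=> oO; case: j => [|j]; split => //;
  try by move=> x _; exact: coord_continuous.
move=> l; split=> [x _|]; first by have [] := is_derive_coord x (evec l) i.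
apply: Ck_eq oO _ (Ck_cst j O ((evec l : 'rV[R]_k) 0 i)) => x _.
by have [_ ->] := is_derive_coord x (evec l) i.
Qed.

Lemma Ck_comp j k l (O : set 'rV[R]_k) (O' : set 'rV[R]_l) f
    (g : 'rV[R]_l -> 'rV[R]_k) : open O -> open O' ->
  (forall x, O' x -> O (g x)) -> Ck j O f ->
  (forall i, Ck j O' (fun x => g x 0 i)) -> Ck j O' (fun x => f (g x)).
Proof.
move=> oO oO' gO.
have cont m h x : O' x -> Ck m O h -> (forall i, Ck m O' (fun x => g x 0 i)) ->
    {for x, continuous (fun x => h (g x))}.
  move=> Ox hC gC; apply: continuous_comp; last exact: Ck_continuous hC (gO _ Ox).
  by apply: rV_continuous => i; exact: Ck_continuous (gC i) Ox.
elim: j f => [|j IH] f fC gC; split => //;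
  try by move=> x Ox; exact: cont Ox fC gC.
move=> i.
have ch x : O' x -> is_derive x (evec i) (fun x => f (g x))
    (\sum_a 'D_(evec i) (fun y => g y 0 a) x * 'D_(evec a) f (g x)).
  move=> Ox; apply: is_derive_chain.
    exact: Ck_differentiable oO (gO _ Ox) fC.
  by move=> a; exact: Ck_derivable (gC a) Ox.
split=> [x Ox|]; first by have [] := ch x Ox.
apply: (@Ck_eq l j O' (fun x => \sum_a 'D_(evec i) (fun y => g y 0 a) x
     * 'D_(evec a) f (g x))) => //.
  by move=> x Ox; have [_ ->] := ch x Ox.
apply: Ck_sum => // a _; apply: CkM => //; first by have [_ /(_ i)[]] := gC a.
apply: (IH (fun y => 'D_(evec a) f y)); first by have [_ /(_ a)[]] := fC.
by move=> b; exact: Ck_pred.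
Qed.
End Calculus.

(** * Bump functions on R^k *)

Section Bump.
Context {R : realType}.

(** The factor [t^-j] makes the family closed under differentiation up to
    linear combinations, so that all its members are shown to be smooth by one
    induction on the order. *)
Definition flat (j : nat) (t : R) : R :=
  if 0 < t then t^-1 ^+ j * expR (- t^-1) else 0.

Lemma flat_le0 j t : t <= 0 -> flat j t = 0.
Proof. by rewrite /flat ltNge => ->. Qed.

Lemma flat_gt0 t : 0 < t -> 0 < flat 0 t.
Proof. by move=> t0; rewrite /flat t0 expr0 mul1r expR_gt0. Qed.

Lemma flat_ge0 j t : 0 <= flat j t.
Proof.
rewrite /flat; case: ifP => // t0.
by rewrite mulr_ge0 ?expR_ge0 // exprn_ge0 // invr_ge0 ltW.
Qed.

(** From [exp x >= x^(j+1) / (j+1)!] at [x = 1/t]. *)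
Lemma flat_bound j t : flat j t <= j.+1`!%:R * `|t|.
Proof.
have [t0|t0] := leP t 0; first by rewrite flat_le0.
rewrite /flat t0 gtr0_norm // expRN.
have x0 : 0 < t^-1 by rewrite invr_gt0.
have fac : 0 < (j.+1`!%:R : R) by rewrite ltr0n fact_gt0.
rewrite ler_pdivrMr ?expR_gt0 //.
have := expR_ge1Dxn j (ltW x0); set E := expR _ => hE.
have hE' : t^-1 ^+ j.+1 <= j.+1`!%:R * E.
  rewrite mulrC -ler_pdivrMr //; apply: le_trans hE; rewrite lerDr; exact: ler01.
have -> : t^-1 ^+ j = t * t^-1 ^+ j.+1 by rewrite exprS mulrA divff ?mul1r // gt_eqF.
by rewrite -mulrA [t * E]mulrC mulrA [leRHS]mulrC ler_pM2l.
Qed.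

Lemma flat_continuous0 j : flat j t @[t --> 0] --> (0 : R).
Proof.
apply/cvgrPdist_le => e e0.
have fac : 0 < (j.+1`!%:R : R) by rewrite ltr0n fact_gt0.
near=> t.
rewrite sub0r normrN ger0_norm ?flat_ge0 //.
apply: le_trans (flat_bound _ _) _; rewrite mulrC -ler_pdivlMr //.
near: t; exact/(@nbhs0_le R R)/divr_gt0.
Unshelve. all: by end_near. Qed.

Lemma is_derive_flat j (t : R) :
  is_derive t 1 (flat j) (flat j.+2 t - j%:R * flat j.+1 t).
Proof.
have [t0|t0|->] := ltgtP t 0.
- rewrite !flat_le0 ?(ltW t0) // mulr0 subr0.
  apply: (@near_eq_is_derive _ _ _ (cst 0)).
  by near=> z; rewrite flat_le0 // ltW //; near: z; exact: lt_nbhsl.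
- apply: (@near_eq_is_derive _ _ _
      ((fun u : R => u ^+ j * expR (- u)) \o (fun z : R => z^-1))).
    near=> z; rewrite /flat ifT //; near: z; exact: lt_nbhsr.
  have dV : is_derive t 1 (fun z : R => z^-1) (- t ^- 2 *: 1).
    by apply: is_deriveV; rewrite ?gt_eqF.
  have dE (u : R) : is_derive u 1 (fun u : R => expR (- u)) (expR (- u) * -1).
    by apply: (@is_derive1_comp _ expR (fun u : R => - u)).
  have dX (u : R) : is_derive u 1 (fun u : R => u ^+ j) (j%:R * u ^+ j.-1).
    apply: DeriveDef; first exact: exprn_derivable.
    by rewrite exp_derive [_ *: 1]mulr1.
  have dP (u : R) : is_derive u 1 (fun u : R => u ^+ j * expR (- u)) _ :=
    is_deriveM (dX u) (dE u).
  apply: (is_derive_eq (is_derive1_comp (dP _) dV)).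
  rewrite /flat t0 [_ *: 1]mulr1 -exprVn; set u := t^-1.
  rewrite /GRing.scale /=.
  case: (j) => [|l] /=; first by rewrite !mul0r; ring.
  by rewrite !exprS; ring.
- rewrite !flat_le0 // mulr0 subr0.
  (* [flat j t = flat j.+1 t * t], and [flat j.+1] tends to 0 at 0 *)
  apply/is_derive1_caratheodory; exists (flat j.+1); split.
  + move=> z; rewrite [flat j 0]flat_le0 // !subr0.
    have [z0|z0] := leP z 0; first by rewrite !flat_le0 // mul0r.
    by rewrite /flat z0 exprSr; field; rewrite gt_eqF.
  + by rewrite /prop_for /continuous_at flat_le0 //; exact: flat_continuous0.
  + by rewrite flat_le0.
Unshelve. all: by end_near. Qed.

Lemma is_derive_comp1 (V : normedModType R) (h : R -> R) (f : V -> R) (x v : V)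
    (a : R) : is_derive (f x) 1 h a -> derivable f x v ->
  is_derive x v (fun y => h (f y)) (a * 'D_v f x).
Proof.
move=> dh df.
have fx : f (0 *: v + x) = f x by rewrite scale0r add0r.
have df0 : derivable f (0 *: v + x) v by rewrite scale0r add0r.
have dl := is_derive_line df0.
have dh0 : is_derive (f (0 *: v + x)) 1 h a by rewrite fx.
have dc := is_derive1_comp dh0 dl.
apply: DeriveDef; first by apply/derivable1P; case: dc.
have [_] := dc; rewrite scale0r add0r => <-.
by rewrite (derive_line (fun y => h (f y))) scale0r add0r.
Qed.

Lemma Ck_flat k j (O : set 'rV[R]_k) (f : 'rV[R]_k -> R) i : open O -> Ck j O f ->
  Ck j O (fun x => flat i (f x)).
Proof.
move=> oO; elim: j f i => [|j IH] f i fC; split => //.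
- move=> x Ox; apply: continuous_comp; first exact: Ck_continuous fC Ox.
  apply/differentiable_continuous/derivable1_diffP.
  by case: (is_derive_flat i (f x)).
- move=> x Ox; apply: continuous_comp; first exact: Ck_continuous fC Ox.
  apply/differentiable_continuous/derivable1_diffP.
  by case: (is_derive_flat i (f x)).
- move=> l; have [_ /(_ l)[fd fC']] := fC.
  have d x (Ox : O x) := is_derive_comp1 (is_derive_flat i (f x)) (fd x Ox).
  split=> [x Ox|]; first by case: (d x Ox).
  apply: (@Ck_eq _ _ _ _ (fun x => (flat i.+2 (f x) + (- i%:R) * flat i.+1 (f x))
     * 'D_(evec l) f x)) => //.
    by move=> x Ox; case: (d x Ox) => _ ->; rewrite mulNr.
  apply: CkM => //; apply: CkD => //; first exact/IH/Ck_pred.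
  by apply: CkZ => //; exact/IH/Ck_pred.
Qed.

Definition step (t : R) := flat 0 t / (flat 0 t + flat 0 (1 - t)).

Lemma step_den_gt0 t : 0 < flat 0 t + flat 0 (1 - t).
Proof.
have [t0|t0] := leP t 0.
  by rewrite flat_le0 // add0r flat_gt0 // subr_gt0 (le_lt_trans t0).
by rewrite ltr_pwDl ?flat_gt0 ?flat_ge0.
Qed.

Lemma Ck_step k j (O : set 'rV[R]_k) (f : 'rV[R]_k -> R) : open O -> Ck j O f ->
  Ck j O (fun x => step (f x)).
Proof.
move=> oO fC; apply: CkM => //; first exact: Ck_flat.
apply: CkV => // [x _|]; first by rewrite gt_eqF // step_den_gt0.
apply: CkD => //; first exact: Ck_flat.
apply: Ck_flat => //; apply: (@Ck_eq _ _ _ _ (fun x => 1 + (-1) * f x)) => //.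
  by move=> x _; rewrite mulN1r.
by apply: CkD => //; [exact: Ck_cst|exact: CkZ].
Qed.

Lemma rV_bump k (a : 'rV[R]_k) (e : R) : 0 < e ->
  exists phi : 'rV[R]_k -> R, [/\ smooth_on setT phi,
    \forall x \near a, phi x = 1 & forall x, phi x != 0 -> `|x - a| <= e].
Proof.
move=> e0; pose q (x : 'rV[R]_k) := 2 + (- (e / 2) ^- 2) * \sum_i (x 0 i - a 0 i) ^+ 2.
have r0 : 0 < (e / 2) ^+ 2 by rewrite exprn_gt0 // divr_gt0.
have qC j : Ck j setT q.
  apply: CkD; [exact: openT|exact: Ck_cst|].
  apply: CkZ; first exact: openT.
  apply: Ck_sum => [|i _]; first exact: openT.
  have cC : Ck j setT (fun x : 'rV[R]_k => x 0 i - a 0 i).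
    by apply: CkD; [exact: openT|apply: Ck_coord; exact: openT|exact: Ck_cst].
  by apply: CkM; first exact: openT.
(* [q a = 2], and [q > 0] only in the ball of radius [sqrt 2 * e / 2 < e] *)
exists (fun x => step (q x)); split.
- by move=> j; apply: Ck_step; first exact: openT.
- have qa : q a = 2 by rewrite /q big1 ?mulr0 ?addr0 // => i _; rewrite subrr expr0n.
  have : \forall x \near a, 1 < q x.
    have := @Ck_continuous _ _ _ _ _ a (qC 0%N) I.
    rewrite /prop_for /continuous_at qa => /cvgr_gt; apply.
    by rewrite ltr1n.
  apply: filterS => x q1.
  have q0 : 0 < q x by apply: lt_trans q1.
  rewrite /step [flat 0 (1 - _)]flat_le0 ?subr_le0 ?(ltW q1) // addr0 divff //.
  by rewrite gt_eqF // flat_gt0.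
- move=> x sx; have q0 : 0 < q x.
    by rewrite ltNge; apply/negP => q0; move: sx; rewrite /step flat_le0 // mul0r eqxx.
  have sq : \sum_i (x 0 i - a 0 i) ^+ 2 < e ^+ 2.
    move: q0; rewrite /q mulNr subr_gt0 mulrC ltr_pdivrMr // => /lt_le_trans; apply.
    rewrite expr_div_n; lra.
  rewrite /Num.Def.normr /= mx_normrE; apply: bigmax_le; first exact: ltW.
  move=> -[i j] _ /=; rewrite ord1 !mxE.
  have : `|x 0 j - a 0 j| ^+ 2 <= e ^+ 2.
    rewrite real_normK ?num_real //; apply/ltW/(le_lt_trans _ sq).
    by rewrite (bigD1 j) //= lerDl; apply: sumr_ge0 => l _; exact: sqr_ge0.
  by rewrite ler_pXn2r // nnegrE // ltW.
Qed.
End Bump.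

(** * Germs of smooth functions on R^k *)

Lemma continuous_nbhs (T U : topologicalType) (f : T -> U) (x : T) (B : set U) :
  {for x, continuous f} -> nbhs (f x) B -> \forall y \near x, B (f y).
Proof. by move=> fc /fc. Qed.

Section SmoothAt.
Context {R : realType}.

Definition smooth_at k (x : 'rV[R]_k) (f : 'rV[R]_k -> R) : Prop :=
  exists2 O, open_nbhs x O & smooth_on O f.

Section Ops.
Context {k : nat}.
Implicit Types (x : 'rV[R]_k) (f g : 'rV[R]_k -> R).

Lemma smooth_atW x f U : smooth_at x f -> nbhs x U ->
  exists O, [/\ open_nbhs x O, O `<=` U & smooth_on O f].
Proof.
move=> [ O [oO Ox] fO] nU; have : nbhs x (O `&` U).
  by apply: filterI => //; exact: open_nbhs_nbhs.
rewrite nbhsE => -[V oV VOU]; exists V; split=> //; first by move=> y /VOU[].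
by move=> j; apply: Ck_sub (fO j) => y /VOU[].
Qed.

Lemma smooth_at_eq x f g : {near x, f =1 g} -> smooth_at x f -> smooth_at x g.
Proof.
move=> efg sf; have [ O [oO Ofg fO]] := smooth_atW sf efg.
exists O => // j; apply: Ck_eq (fO j) => //; exact: oO.1.
Qed.

Lemma smooth_at_ext x f g : f =1 g -> smooth_at x f -> smooth_at x g.
Proof. by move=> /funext ->. Qed.

Lemma smooth_at2 x f g : smooth_at x f -> smooth_at x g ->
  exists O, [/\ open_nbhs x O, smooth_on O f & smooth_on O g].
Proof.
move=> sf [ O' oO' gO']; have [ O [oO OO' fO]] := smooth_atW sf (open_nbhs_nbhs oO').
by exists O; split=> // j; exact: Ck_sub (gO' j).
Qed.

Lemma smooth_at_cst x (c : R) : smooth_at x (fun=> c).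
Proof. by exists setT; [exact: open_nbhsT|move=> j; exact: Ck_cst]. Qed.

Lemma smooth_atD x f g : smooth_at x f -> smooth_at x g ->
  smooth_at x (fun y => f y + g y).
Proof.
move=> sf sg; have [ O [oO fO gO]] := smooth_at2 sf sg.
by exists O => // j; apply: CkD => //; exact: oO.1.
Qed.

Lemma smooth_atM x f g : smooth_at x f -> smooth_at x g ->
  smooth_at x (fun y => f y * g y).
Proof.
move=> sf sg; have [ O [oO fO gO]] := smooth_at2 sf sg.
by exists O => // j; apply: CkM => //; exact: oO.1.
Qed.

Lemma smooth_at_differentiable x f : smooth_at x f -> differentiable f x.
Proof. by move=> [ O [oO Ox] /(_ 1%N)]; exact: Ck_differentiable. Qed.

Lemma smooth_at_continuous x f : smooth_at x f -> {for x, continuous f}.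
Proof. by move=> [ O [oO Ox] /(_ 0%N) fC]; exact: Ck_continuous fC Ox. Qed.

Lemma smooth_atV x f : f x != 0 -> smooth_at x f ->
  smooth_at x (fun y => (f y)^-1).
Proof.
move=> fx0 sf; have fn0 : \forall y \near x, f y != 0.
  apply: (continuous_nbhs (B := [set y | y != 0]) (smooth_at_continuous sf)).
  by apply: open_nbhs_nbhs; split; first exact: open_neq.
have [ O [oO On0 fO]] := smooth_atW sf fn0.
by exists O => // j; apply: CkV => //; exact: oO.1.
Qed.

Lemma smooth_at_partial x f i : smooth_at x f ->
  smooth_at x (fun y => 'D_(evec i) f y).
Proof.
by move=> [ O oO fO]; exists O => // j; have [_ /(_ i)[]] := fO j.+1.
Qed.

Lemma smooth_at_coord x i : smooth_at x (fun y => y 0 i).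
Proof.
by exists setT; [exact: open_nbhsT|move=> j; apply: Ck_coord; exact: openT].
Qed.

End Ops.

Lemma smooth_at_comp k l (f : 'rV[R]_k -> R) (g : 'rV[R]_l -> 'rV[R]_k) x :
  smooth_at (g x) f -> (forall i, smooth_at x (fun y => g y 0 i)) ->
  smooth_at x (fun y => f (g y)).
Proof.
move=> [ O [oO Ogx] fO] sg.
have gc : {for x, continuous g}.
  by apply: rV_continuous => i; exact: smooth_at_continuous.
have /choice[U HU] : forall i : 'I_k, exists U, open_nbhs x U /\
   smooth_on U (fun y => g y 0 i).
  by move=> i; have [U] := sg i; exists U.
have nU : nbhs x (fun y => forall i, U i y).
  apply: (@filter_forall _ _ _ (nbhs x) (nbhs_filter x)) => i.
  by apply: open_nbhs_nbhs; case: (HU i).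
have nO : nbhs x (fun y => O (g y)) by apply: continuous_nbhs gc _; exact: open_nbhs_nbhs.
have : nbhs x ((fun y => forall i, U i y) `&` (fun y => O (g y))).
  exact: filterI.
rewrite nbhsE => -[V [oV Vx] VUO].
exists V => // j; apply: (Ck_comp oO oV _ (fO j)) => [y /VUO[]//|i].
by apply: Ck_sub ((HU i).2 j) => y /VUO[].
Qed.

End SmoothAt.

(** * Smooth functions and tangent vectors in arbitrary charts *)

(** What the calculus of smooth functions uses of an atlas; it holds for the
    atlas of a manifold and for the adapted charts of the total space. *)
Record smooth_atlas (R : realType) (T : Type) (k : nat)
    (A : set (chart R T k)) : Prop := {
  sa_open : forall c c', A c -> A c' -> open (cmap c @` (cdom c `&` cdom c'));
  sa_mapK : forall c p, A c -> cdom c p -> cinv c (cmap c p) = p;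
  sa_compat : forall c c', A c -> A c' -> chart_compat c c' }.

Section AtlasCalculus.
Context {R : realType} {T : Type} {k : nat}.
Variable A : set (chart R T k).
Hypothesis sA : smooth_atlas A.
Implicit Types (c : chart R T k) (p : T) (f g : T -> R).

Lemma chart_near c c' p : A c -> A c' -> cdom c p -> cdom c' p ->
  \forall x \near cmap c p,
    [/\ cdom c (cinv c x), cdom c' (cinv c x) & cmap c (cinv c x) = x].
Proof.
move=> Ac Ac' cp c'p; apply: (open_near (sa_open sA Ac Ac')).
  by exists p.
by move=> _ [p' [cp' c'p'] <-]; rewrite (sa_mapK sA).
Qed.

Lemma transition_smooth c c' p i : A c -> A c' -> cdom c p -> cdom c' p ->
  smooth_at (cmap c p) (fun x => cmap c' (cinv c x) 0 i).
Proof.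
move=> Ac Ac' cp c'p; exists (cmap c @` (cdom c `&` cdom c')).
  by split; [exact: (sa_open sA)|exists p].
exact: (sa_compat sA Ac Ac' i).
Qed.

Lemma transition_continuous c c' p : A c -> A c' -> cdom c p -> cdom c' p ->
  cmap c' (cinv c x) @[x --> cmap c p] --> cmap c' p.
Proof.
move=> Ac Ac' cp c'p; rewrite -{2}(sa_mapK sA Ac cp).
apply: rV_continuous => i; exact/smooth_at_continuous/transition_smooth.
Qed.

Lemma near_change c c' p (P : T -> Prop) :
  A c -> A c' -> cdom c p -> cdom c' p ->
  (\forall x \near cmap c p, P (cinv c x)) ->
  \forall x \near cmap c' p, P (cinv c' x).
Proof.
move=> Ac Ac' cp c'p nP.
have nP' : \forall x \near cmap c' p, P (cinv c (cmap c (cinv c' x))).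
  exact: (transition_continuous Ac' Ac c'p cp nP).
near=> x.
have [_ cx _] : [/\ cdom c' (cinv c' x), cdom c (cinv c' x)
   & cmap c' (cinv c' x) = x] by near: x; exact: chart_near.
rewrite -(sa_mapK sA Ac cx).
by near: x.
Unshelve. all: by end_near. Qed.

Lemma near_ptP c p (P : set T) : A c -> cdom c p ->
  near_pt A p P <-> \forall x \near cmap c p, P (cinv c x).
Proof.
move=> Ac cp; split.
  move=> [c' [ O [Ac' c'p [oO Op] _ OP]]].
  exact: near_change Ac' Ac c'p cp (open_near oO Op OP).
move=> nP; have : nbhs (cmap c p) ((fun x => [/\ cdom c (cinv c x), cdom c (cinv c x)
    & cmap c (cinv c x) = x]) `&` (fun x => P (cinv c x))).
  by apply: filterI => //; exact: chart_near.
rewrite nbhsE => -[ O oO OP]; exists c, O; split=> //.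
  by move=> x /OP[[cx _ <-] _]; exists (cinv c x).
by move=> x /OP[].
Qed.

Lemma near_pt_cover p P : near_pt A p P -> exists2 c, A c & cdom c p.
Proof. by move=> [c [ O [Ac cp _ _ _]]]; exists c. Qed.

Lemma near_ptI p P P' : near_pt A p P -> near_pt A p P' ->
  near_pt A p (P `&` P').
Proof.
move=> nP nP'; have [c Ac cp] := near_pt_cover nP.
apply/(near_ptP _ Ac cp); apply: filterI; exact/(near_ptP _ Ac cp).
Qed.

Lemma near_ptS p (P P' : set T) : P `<=` P' -> near_pt A p P -> near_pt A p P'.
Proof.
by move=> PP' [c [ O [Ac cp oO sO OP]]]; exists c, O; split=> // x /OP/PP'.
Qed.

Lemma near_pt_self p P : near_pt A p P -> P p.
Proof.
by move=> [c [ O [Ac cp [oO Op] sO /(_ _ Op)]]]; rewrite (sa_mapK sA).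
Qed.

Lemma near_pt_chart c p : A c -> cdom c p -> near_pt A p (cdom c).
Proof.
move=> Ac cp; apply/(near_ptP _ Ac cp).
by apply: filterS (chart_near Ac Ac cp cp) => x [].
Qed.

(** The existential chart of [smooth_near] may be replaced by any other one,
    since transition maps are smooth. *)
Lemma smooth_nearP c p f : A c -> cdom c p ->
  smooth_near A p f <-> smooth_at (cmap c p) (f \o cinv c).
Proof.
move=> Ac cp; split; last first.
  have n : nbhs (cmap c p) (cmap c @` cdom c).
    by apply: filterS (chart_near Ac Ac cp cp) => x [cx _ <-]; exists (cinv c x).
  by move=> /smooth_atW/(_ n)[ O [oO sO fO]]; exists c, O.
move=> [c' [ O [Ac' c'p oO sO fO]]].
apply: (@smooth_at_eq _ _ _ (fun x => (f \o cinv c') (cmap c' (cinv c x)))).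
  apply: filterS (chart_near Ac Ac' cp c'p) => x [cx c'x _] /=.
  by rewrite (sa_mapK sA).
apply: smooth_at_comp; first by rewrite (sa_mapK sA) //; exists O.
by move=> i; exact: transition_smooth.
Qed.

Lemma smooth_near_cover p f : smooth_near A p f -> exists2 c, A c & cdom c p.
Proof. by move=> [c [ O [Ac cp _ _ _]]]; exists c. Qed.

Lemma smooth_near_eq p f g : near_pt A p (fun p' => f p' = g p') ->
  smooth_near A p f -> smooth_near A p g.
Proof.
move=> efg sf; have [c Ac cp] := smooth_near_cover sf.
apply/(smooth_nearP _ Ac cp).
apply: smooth_at_eq (iffLR (smooth_nearP _ Ac cp) sf).
exact: (iffLR (near_ptP (fun p' => f p' = g p') Ac cp) efg).
Qed.

Lemma smooth_near_near p f : smooth_near A p f ->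
  near_pt A p (fun p' => smooth_near A p' f).
Proof.
move=> [c [ O [Ac cp oO sO fO]]]; exists c, O; split=> // x Ox.
have [p' cp' xE] := sO _ Ox; rewrite -xE (sa_mapK sA) //.
by exists c, O; split=> //; rewrite xE; split=> //; exact: oO.1.
Qed.

Lemma smooth_near_cst c p (a : R) : A c -> cdom c p -> smooth_near A p (fun=> a).
Proof. by move=> Ac cp; apply/(smooth_nearP _ Ac cp); exact: smooth_at_cst. Qed.

Lemma smooth_nearD p f g : smooth_near A p f -> smooth_near A p g ->
  smooth_near A p (fun p' => f p' + g p').
Proof.
move=> sf sg; have [c Ac cp] := smooth_near_cover sf.
apply/(smooth_nearP _ Ac cp).
by apply: smooth_atD; exact/(smooth_nearP _ Ac cp).
Qed.

Lemma smooth_nearM p f g : smooth_near A p f -> smooth_near A p g ->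
  smooth_near A p (fun p' => f p' * g p').
Proof.
move=> sf sg; have [c Ac cp] := smooth_near_cover sf.
apply/(smooth_nearP _ Ac cp).
by apply: smooth_atM; exact/(smooth_nearP _ Ac cp).
Qed.

Lemma smooth_nearZ p (a : R) f : smooth_near A p f ->
  smooth_near A p (fun p' => a * f p').
Proof.
move=> sf; have [c Ac cp] := smooth_near_cover sf.
by apply: smooth_nearM => //; exact: smooth_near_cst Ac cp.
Qed.

Lemma smooth_nearN p f : smooth_near A p f -> smooth_near A p (fun p' => - f p').
Proof.
move=> /(smooth_nearZ (-1)); congr smooth_near.
by apply/funext => p'; rewrite mulN1r.
Qed.

Lemma smooth_nearV p f : f p != 0 -> smooth_near A p f ->
  smooth_near A p (fun p' => (f p')^-1).
Proof.
move=> f0 sf; have [c Ac cp] := smooth_near_cover sf.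
apply/(smooth_nearP _ Ac cp); apply: smooth_atV.
  by rewrite /= (sa_mapK sA).
exact/(smooth_nearP _ Ac cp).
Qed.

Lemma smooth_near_sum c p (I : Type) (r : seq I) (P : pred I) (F : I -> T -> R) :
  A c -> cdom c p -> (forall i, P i -> smooth_near A p (F i)) ->
  smooth_near A p (fun p' => \sum_(i <- r | P i) F i p').
Proof.
move=> Ac cp sF; elim: r => [|i r IH].
  apply: smooth_near_eq (smooth_near_cst 0 Ac cp).
  by apply: near_ptS (near_pt_chart Ac cp) => p' _; rewrite big_nil.
case Pi : (P i); last first.
  apply: smooth_near_eq IH.
  by apply: near_ptS (near_pt_chart Ac cp) => p' _; rewrite big_cons Pi.
apply: smooth_near_eq (smooth_nearD (sF _ Pi) IH).
by apply: near_ptS (near_pt_chart Ac cp) => p' _; rewrite big_cons Pi.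
Qed.

Lemma smooth_near_prod c p (I : Type) (r : seq I) (P : pred I) (F : I -> T -> R) :
  A c -> cdom c p -> (forall i, P i -> smooth_near A p (F i)) ->
  smooth_near A p (fun p' => \prod_(i <- r | P i) F i p').
Proof.
move=> Ac cp sF; elim: r => [|i r IH].
  apply: smooth_near_eq (smooth_near_cst 1 Ac cp).
  by apply: near_ptS (near_pt_chart Ac cp) => p' _; rewrite big_nil.
case Pi : (P i); last first.
  apply: smooth_near_eq IH.
  by apply: near_ptS (near_pt_chart Ac cp) => p' _; rewrite big_cons Pi.
apply: smooth_near_eq (smooth_nearM (sF _ Pi) IH).
by apply: near_ptS (near_pt_chart Ac cp) => p' _; rewrite big_cons Pi.
Qed.

Lemma smooth_near_coord c p i : A c -> cdom c p ->
  smooth_near A p (fun p' => cmap c p' 0 i).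
Proof.
by move=> Ac cp; apply/(smooth_nearP _ Ac cp); exact: transition_smooth.
Qed.

Lemma smooth_near_pder c p i f : A c -> cdom c p -> smooth_near A p f ->
  smooth_near A p (pder c i f).
Proof.
move=> Ac cp /(smooth_nearP _ Ac cp) sf; apply/(smooth_nearP _ Ac cp).
apply: smooth_at_eq (smooth_at_partial i sf).
by apply: filterS (chart_near Ac Ac cp cp) => x [_ _ xE]; rewrite /= /pder xE.
Qed.

(** ** Tangent vectors *)

Lemma coord_vecE c p w f : A c -> cdom c p -> smooth_near A p f ->
  coord_vec A c p w f = \sum_i w 0 i * pder c i f p.
Proof.
move=> Ac cp sf; rewrite /coord_vec asboolT //.
by apply: derive_partials; apply/smooth_at_differentiable/(smooth_nearP _ Ac cp).
Qed.

Lemma coord_vec0 c p w f : ~ smooth_near A p f -> coord_vec A c p w f = 0.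
Proof. by move=> sf; rewrite /coord_vec asboolF. Qed.

Lemma coord_vec_linear c p (a : R) w w' : A c -> cdom c p ->
  coord_vec A c p (a *: w + w') = a *: coord_vec A c p w + coord_vec A c p w'.
Proof.
move=> Ac cp; apply/funext => f; rewrite !fctE /=.
have [sf|sf] := pselect (smooth_near A p f); last first.
  by rewrite !coord_vec0 // addr0 /GRing.scale /= mulr0.
rewrite !coord_vecE // /GRing.scale /= mulr_sumr -big_split /=.
by apply: eq_bigr => i _; rewrite !mxE mulrDl mulrA.
Qed.

Lemma pder_coord c p i j : A c -> cdom c p ->
  pder c i (fun p' => cmap c p' 0 j) p = (i == j)%:R.
Proof.
move=> Ac cp; rewrite /pder.
rewrite (@near_eq_derive _ _ _ _ (fun x : 'rV[R]_k => x 0 j)); last first.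
  by apply: filterS (chart_near Ac Ac cp cp) => x [_ _ xE] /=; rewrite xE.
have [_ ->] := is_derive_coord (cmap c p) (evec i) j.
by rewrite mxE eqxx eq_sym.
Qed.

(** The components of a tangent vector transform by the chain rule, hence they
    can be read off in any chart from its action on the coordinates. *)
Lemma tangentE c p v : tangent A p v -> A c -> cdom c p ->
  v = coord_vec A c p (\row_i v (fun p' => cmap c p' 0 i)).
Proof.
move=> [c' [w [Ac' c'p vE]]] Ac cp; apply/funext => f.
have [sf|sf] := pselect (smooth_near A p f); last first.
  by rewrite [RHS]coord_vec0 // vE coord_vec0.
rewrite coord_vecE // vE {1}/coord_vec asboolT //.
rewrite (@near_eq_derive _ _ _ _ (fun x => (f \o cinv c) (cmap c (cinv c' x)))).
  have df : differentiable (f \o cinv c) (cmap c (cinv c' (cmap c' p))).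
    rewrite (sa_mapK sA) //; exact/smooth_at_differentiable/(smooth_nearP _ Ac cp).
  have dt i : derivable (fun x => cmap c (cinv c' x) 0 i) (cmap c' p) w.
    exact/diff_derivable/smooth_at_differentiable/transition_smooth.
  have [_ ->] := is_derive_chain df dt.
  apply: eq_bigr => i _; rewrite mxE (sa_mapK sA) //; congr (_ * _).
  by rewrite /coord_vec asboolT //; exact: smooth_near_coord.
apply: filterS (chart_near Ac' Ac c'p cp) => x [_ cx _] /=.
by rewrite (sa_mapK sA).
Qed.

Lemma tangent_sum c p v f : tangent A p v -> A c -> cdom c p ->
  smooth_near A p f ->
  v f = \sum_i v (fun p' => cmap c p' 0 i) * pder c i f p.
Proof.
move=> tv Ac cp sf; rewrite {1}(tangentE tv Ac cp) coord_vecE //.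
by apply: eq_bigr => i _; rewrite mxE.
Qed.

Lemma tangent_linear p (a : R) v v' : tangent A p v -> tangent A p v' ->
  tangent A p (a *: v + v').
Proof.
move=> tv tv'; have [c [_ [Ac cp _]]] := tv.
rewrite (tangentE tv Ac cp) (tangentE tv' Ac cp) -coord_vec_linear //.
by eexists; eexists; split; [exact: Ac| exact: cp|].
Qed.

Section Derivation.
Variables (p : T) (v : (T -> R) -> R).
Hypothesis tv : tangent A p v.

Lemma tangent_near_eq f g : near_pt A p (fun p' => f p' = g p') -> v f = v g.
Proof.
have [c [w [Ac cp ->]]] := tv; move=> efg; rewrite /coord_vec.
have -> : smooth_near A p f = smooth_near A p g.
  apply/propext; split; apply: smooth_near_eq => //.
  by apply: near_ptS efg => p' ->.
case: ifP => // _; apply: near_eq_derive.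
exact/(near_ptP (fun p' => f p' = g p') Ac cp).
Qed.

Lemma tangent_is_derive c w f : A c -> cdom c p -> v = coord_vec A c p w ->
  smooth_near A p f -> is_derive (cmap c p) w (f \o cinv c) (v f).
Proof.
move=> Ac cp vE sf.
have df : differentiable (f \o cinv c) (cmap c p).
  exact/smooth_at_differentiable/(smooth_nearP _ Ac cp).
apply: DeriveDef; first exact: diff_derivable.
by rewrite vE /coord_vec asboolT.
Qed.

Lemma tangentD f g : smooth_near A p f -> smooth_near A p g ->
  v (fun p' => f p' + g p') = v f + v g.
Proof.
move=> sf sg; have [c [w [Ac cp vE]]] := tv.
have df := tangent_is_derive Ac cp vE sf.
have dg := tangent_is_derive Ac cp vE sg.
have [_ <-] := tangent_is_derive Ac cp vE (smooth_nearD sf sg).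
by have [_ <-] := is_deriveD df dg.
Qed.

Lemma tangentM f g : smooth_near A p f -> smooth_near A p g ->
  v (fun p' => f p' * g p') = f p * v g + g p * v f.
Proof.
move=> sf sg; have [c [w [Ac cp vE]]] := tv.
have df := tangent_is_derive Ac cp vE sf.
have dg := tangent_is_derive Ac cp vE sg.
have [_ <-] := tangent_is_derive Ac cp vE (smooth_nearM sf sg).
by have [_ ->] := is_deriveM df dg; rewrite /= (sa_mapK sA).
Qed.

Lemma tangent_cst (a : R) : v (fun=> a) = 0.
Proof.
have [c [w [Ac cp vE]]] := tv.
rewrite vE /coord_vec; case: ifP => // _.
by rewrite (derive_cst a (cmap c p) w).
Qed.

Lemma tangentZ (a : R) f : smooth_near A p f ->
  v (fun p' => a * f p') = a * v f.
Proof.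
move=> sf; have [c Ac cp] := smooth_near_cover sf.
by rewrite tangentM ?tangent_cst ?mulr0 ?addr0 //; exact: smooth_near_cst Ac cp.
Qed.

Lemma tangentN f : smooth_near A p f -> v (fun p' => - f p') = - v f.
Proof.
move=> sf; rewrite -[RHS]mulN1r -tangentZ //; congr v.
by apply/funext => p'; rewrite mulN1r.
Qed.

Lemma tangentB f g : smooth_near A p f -> smooth_near A p g ->
  v (fun p' => f p' - g p') = v f - v g.
Proof.
by move=> sf sg; rewrite tangentD ?tangentN //; exact: smooth_nearN.
Qed.

Lemma tangent_bigsum (I : Type) (r : seq I) (F : I -> T -> R) :
  (forall i, smooth_near A p (F i)) ->
  v (fun p' => \sum_(i <- r) F i p') = \sum_(i <- r) v (F i).
Proof.
move=> sF; have [c [w [Ac cp _]]] := tv.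
elim: r => [|i r IH].
  rewrite [RHS]big_nil -[RHS](tangent_cst 0); congr v; apply/funext => p'.
  by rewrite big_nil.
rewrite big_cons -IH -tangentD //; last exact: smooth_near_sum Ac cp _.
by congr v; apply/funext => p'; rewrite big_cons.
Qed.

End Derivation.

Lemma coord_vec_tangent c p w : A c -> cdom c p -> tangent A p (coord_vec A c p w).
Proof. by exists c, w. Qed.

End AtlasCalculus.

(** * The atlas of a manifold and its bump functions *)

Lemma open_nbhs_all (T : topologicalType) (U : set T) :
  (forall x, U x -> nbhs x U) -> open U.
Proof. by move=> H; rewrite openE => x /H. Qed.

Section Manifold.
Context {R : realType} {n : nat} {Q : manifold R n}.

Lemma chart_imgI_open (c : chart R Q n) (U : set Q) : is_chart c -> open U ->
  open (cmap c @` (cdom c `&` U)).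
Proof.
move=> ic oU; apply: open_nbhs_all => _ [q [cq Uq] <-].
have iq : (cmap c @` cdom c) (cmap c q) by exists q.
have nU : \forall x \near cmap c q, U (cinv c x).
  apply: continuous_nbhs (chart_inv_cont ic iq) _.
  by rewrite (chart_mapK ic cq); exact: open_nbhs_nbhs.
apply: filterS2 nU (open_nbhs_nbhs (conj (chart_img_open ic) iq)) => x Ux.
by move=> [q' cq' xE]; exists q' => //; split => //; rewrite -(chart_mapK ic cq') xE.
Qed.

Lemma manifold_smooth_atlas : smooth_atlas (atlas Q).
Proof.
split=> [c c' Ac Ac'|c p Ac|].
- by apply: chart_imgI_open; [|apply: chart_dom_open]; exact: atlas_chart.
- exact/chart_mapK/atlas_chart.
- exact: atlas_compat.
Qed.

Lemma near_pt_nbhs (q : Q) (P : set Q) :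
  near_pt (atlas Q) q P <-> \forall q' \near q, P q'.
Proof.
have [c Ac cq] := atlas_cover q; have ic := atlas_chart Ac.
rewrite (near_ptP manifold_smooth_atlas P Ac cq); split=> [nP|nP].
  have nP' : \forall q' \near q, P (cinv c (cmap c q')).
    exact: continuous_nbhs (chart_map_cont ic cq) nP.
  apply: filterS2 nP' (open_nbhs_nbhs (conj (chart_dom_open ic) cq)) => q'.
  by move=> + cq'; rewrite (chart_mapK ic cq').
have iq : (cmap c @` cdom c) (cmap c q) by exists q.
apply: (continuous_nbhs (chart_inv_cont ic iq)).
by rewrite (chart_mapK ic cq).
Qed.

(** The last clause places the closed support of [chi] inside [U]; it is what
    makes products with functions that are smooth only on [U] smooth. *)
Definition cutoff (q : Q) (U : set Q) (chi : Q -> R) : Prop :=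
  [/\ smooth_fun (atlas Q) chi, \forall q' \near q, chi q' = 1 &
      forall q', ~ U q' -> \forall q'' \near q', chi q'' = 0].

(** The closed support is compact in the chart, hence closed in [Q] because [Q]
    is Hausdorff; so the extension by zero is smooth. *)
Lemma cutoff_exists (q : Q) (U : set Q) : open U -> U q ->
  exists chi, cutoff q U chi.
Proof.
move=> oU Uq; have [c Ac cq] := atlas_cover q; have ic := atlas_chart Ac.
pose W := cmap c @` (cdom c `&` U).
have oW : open W by exact: chart_imgI_open.
have : nbhs (cmap c q) W by apply: open_nbhs_nbhs; split=> //; exists q.
move=> /nbhs_ballP[d /= d0 dW].
have d20 : 0 < d / 2 by rewrite divr_gt0.
have [phi [phiC phi1 phi0]] := rV_bump (cmap c q) d20.
pose B := [set x : 'rV[R]_n | `|x - cmap c q| <= d / 2].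
have BW : B `<=` W.
  move=> x Bx; apply: dW; rewrite -ball_normE /= distrC.
  by apply: le_lt_trans Bx _; rewrite ltr_pdivrMr // ltr_pMr // ltr1n.
have cB : compact B.
  apply: bounded_closed_compact.
    exists (`|cmap c q| + d / 2); split; first exact: num_real.
    move=> M ltM x Bx; apply: ltW; apply: le_lt_trans ltM.
    rewrite -[x](subrK (cmap c q)) addrC; apply: le_trans (ler_normD _ _) _.
    by rewrite lerD2l.
  have -> : B = closed_ball_ (fun z : 'rV[R]_n => `|z|) (cmap c q) (d / 2).
    by apply/seteqP; split=> x; rewrite /B /closed_ball_ /= distrC.
  exact: closed_closed_ball_.
pose K := cinv c @` B.
have cK : closed K.
  apply: compact_closed; first exact: mfd_hausdorff.
  apply: continuous_compact => //; apply: continuous_in_subspaceT => x.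
  rewrite inE => /BW [q' [cq' _] <-].
  by apply: (chart_inv_cont ic); exists q'.
pose chi (q' : Q) : R := if `[< cdom c q' >] then phi (cmap c q') else 0.
have chiK q' : ~ K q' -> chi q' = 0.
  move=> nK; rewrite /chi; case: asboolP => // cq'.
  apply/eqP/negP => /negP h; apply: nK; exists (cmap c q'); last exact: chart_mapK.
  exact: phi0.
have KU q' : K q' -> cdom c q' /\ U q'.
  by move=> [x /BW [q'' [cq'' Uq''] <-] <-]; rewrite (chart_mapK ic).
have chi0 q' : ~ K q' -> \forall q'' \near q', chi q'' = 0.
  move=> nK; have oK : open (~` K) by exact: closed_openC.
  by apply: filterS (open_nbhs_nbhs (conj oK nK)) => q''; exact: chiK.
exists chi; split.
- move=> q'; have [cq'|ncq'] := pselect (cdom c q').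
    apply/(smooth_nearP manifold_smooth_atlas _ Ac cq').
    apply: (@smooth_at_eq _ _ _ phi).
      apply: filterS (chart_near manifold_smooth_atlas Ac Ac cq' cq') => x.
      by move=> [cx _ xE]; rewrite /= /chi asboolT // xE.
    by exists setT; [exact: open_nbhsT|].
  have nK : ~ K q' by move=> /KU[].
  have [c' Ac' c'q'] := atlas_cover q'.
  apply: (smooth_near_eq manifold_smooth_atlas _
    (smooth_near_cst manifold_smooth_atlas 0 Ac' c'q')).
  by apply/near_pt_nbhs; apply: filterS (chi0 _ nK) => q'' ->.
- have nphi : \forall q' \near q, phi (cmap c q') = 1.
    exact: continuous_nbhs (chart_map_cont ic cq) phi1.
  apply: filterS2 nphi (open_nbhs_nbhs (conj (chart_dom_open ic) cq)) => q'.
  by rewrite /chi => + cq'; rewrite asboolT.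
- by move=> q' nU; apply: chi0 => /KU[].
Qed.

End Manifold.

(** * Frames and the adapted charts of the total space *)

Section Frame.
Context {R : realType} {n m : nat} {Q : manifold R n} {E : Q -> lmodType R}.
Variables (e : frame m E) (q : Q).
Hypotheses (fe : is_frame e) (eq : fdom e q).

Lemma fco_linear : linear (@fco _ _ _ _ _ e q).
Proof.
move=> k b b'; rewrite -{1}(frame_vecK fe eq b) -{1}(frame_vecK fe eq b').
rewrite -[RHS](frame_coK fe eq); congr fco.
rewrite scaler_sumr -big_split /=; apply: eq_bigr => a _.
by rewrite !mxE scalerDl scalerA.
Qed.

Lemma fcoZ k b : fco e (k *: b : E q) = k *: fco e b.
Proof.
have fco0 : fco e (0 : E q) = 0.
  by have := fco_linear (-1) 0 0; rewrite scaleN1r oppr0 addr0 scaleN1r addNr.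
by have := fco_linear k b 0; rewrite addr0 fco0 addr0.
Qed.

Lemma fcoD b b' : fco e (b + b' : E q) = fco e b + fco e b'.
Proof. by have := fco_linear 1 b b'; rewrite !scale1r. Qed.

Lemma fco0 : fco e (0 : E q) = 0.
Proof. by rewrite -[0 in LHS](scale0r (0 : E q)) fcoZ scale0r. Qed.

Lemma fco_sum (I : Type) (r : seq I) (F : I -> E q) :
  fco e (\sum_(i <- r) F i) = \sum_(i <- r) fco e (F i).
Proof.
by elim: r => [|i r IH]; rewrite ?big_nil ?fco0 // !big_cons fcoD IH.
Qed.

Lemma fco_vec a : fco e (fvec e q a) = evec a.
Proof.
rewrite -[RHS](frame_coK fe eq); congr fco.
rewrite (bigD1 a) //= big1 ?addr0; first by rewrite mxE !eqxx scale1r.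
by move=> b ba; rewrite mxE (negPf ba) andbF scale0r.
Qed.

Lemma fco_inj (b b' : E q) : fco e b = fco e b' -> b = b'.
Proof. by move=> bb'; rewrite -(frame_vecK fe eq b) bb' frame_vecK. Qed.

End Frame.

Section Total.
Context {R : realType} {n m : nat} {Q : manifold R n} {E : vbundle Q m}.
Implicit Types (c : chart R Q n) (e : frame m E) (p : ExR E).

Lemma adapted_iq c e i p : cmap (adapted c e) p 0 (iq i) = cmap c (base p) 0 i.
Proof. by rewrite /adapted /= /iq row_mxEl row_mxEl. Qed.

Lemma adapted_iy c e a p : cmap (adapted c e) p 0 (iy a) = ycoord e a p.
Proof. by rewrite /adapted /= /iy row_mxEl row_mxEr. Qed.

Lemma adapted_is c e p : cmap (adapted c e) p 0 i_s = scoord p.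
Proof. by rewrite /adapted /= /i_s row_mxEr mxE eqxx. Qed.

Lemma total_index (P : 'I_(n + m + 1) -> Prop) :
  (forall i, P (iq i)) -> (forall a, P (iy a)) -> P i_s -> forall i, P i.
Proof.
move=> Pq Py Ps i; case: (split_ordP i) => j ->; last by rewrite ord1.
by case: (split_ordP j) => l ->; [exact: Pq|exact: Py].
Qed.

Definition qpart (x : 'rV[R]_(n + m + 1)) : 'rV[R]_n := lsubmx (lsubmx x).

Lemma qpartE x i : qpart x 0 i = x 0 (iq i).
Proof. by rewrite !mxE. Qed.

Lemma qpart_cmap c e p : qpart (cmap (adapted c e) p) = cmap c (base p).
Proof. by apply/rowP => i; rewrite qpartE adapted_iq. Qed.

Lemma qpart_continuous : continuous qpart.
Proof.
move=> x; apply: rV_continuous => i.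
have -> : (fun y => qpart y 0 i) = (fun y => y 0 (iq i)).
  by apply/funext => y; rewrite qpartE.
exact: coord_continuous.
Qed.

Lemma qpart_smooth x i : smooth_at x (fun y => qpart y 0 i).
Proof.
have -> : (fun y => qpart y 0 i) = (fun y => y 0 (iq i)).
  by apply/funext => y; rewrite qpartE.
exact: smooth_at_coord.
Qed.

Lemma adapted_mapK c e p : is_chart c -> is_frame e -> cdom (adapted c e) p ->
  cinv (adapted c e) (cmap (adapted c e) p) = p.
Proof.
move=> ic fe [cp ep].
rewrite /adapted /= row_mxKl row_mxKr /= row_mxKl (chart_mapK ic cp).
case: p cp ep => [[q b] s] cp ep; rewrite row_mxKr (frame_vecK fe ep).
by rewrite mxE eqxx.
Qed.

Lemma adapted_cinv c e x : is_chart c -> is_frame e ->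
  (cmap c @` (cdom c `&` fdom e)) (qpart x) ->
  [/\ cdom (adapted c e) (cinv (adapted c e) x),
      base (cinv (adapted c e) x) = cinv c (qpart x)
    & cmap (adapted c e) (cinv (adapted c e) x) = x].
Proof.
move=> ic fe [q [cq eq] xE].
have cx : cinv c (qpart x) = q by rewrite -xE (chart_mapK ic).
have bE : base (cinv (adapted c e) x) = cinv c (qpart x) by [].
split=> //; first by split; rewrite bE cx.
apply/rowP; apply: total_index => [i|a|].
- by rewrite adapted_iq bE cx xE qpartE.
- rewrite adapted_iy /ycoord /= frame_coK ?mxE //.
  by change (fdom e (cinv c (qpart x))); rewrite cx.
- by rewrite adapted_is /scoord /= mxE.
Qed.

Lemma adapted_img c e (D : set Q) : is_chart c -> is_frame e ->
  cmap (adapted c e) @` (cdom (adapted c e) `&` [set p | D (base p)]) =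
  [set x | (cmap c @` (cdom c `&` (fdom e `&` D))) (qpart x)].
Proof.
move=> ic fe; apply/seteqP; split=> x.
  by move=> [p [[cp ep] Dp] <-] /=; exists (base p); rewrite ?qpart_cmap.
move=> [q [cq [eq Dq]] xE].
have [|dx bx cx] := @adapted_cinv c e x ic fe; first by exists q.
exists (cinv (adapted c e) x) => //; split => //=.
by rewrite bx -xE (chart_mapK ic).
Qed.

Lemma smooth_on_at k (O : set 'rV[R]_k) (f : 'rV[R]_k -> R) : open O ->
  (forall x, O x -> smooth_at x f) -> smooth_on O f.
Proof.
move=> oO H j; elim: j f H => [|j IH] f H; split => //;
  try by move=> x /H; exact: smooth_at_continuous.
move=> i; split=> [x /H|]; first by move=> /smooth_at_differentiable/diff_derivable.
by apply: IH => x /H; exact: smooth_at_partial.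
Qed.

(** The fibre coordinates change by the matrix [fco e' (fvec e q b) 0 a], whose
    entries are smooth functions of the base point. *)
Lemma total_smooth_atlas : smooth_atlas (total_atlas E).
Proof.
have sQ := @manifold_smooth_atlas R n Q.
have img_open c c' e e' : atlas Q c -> frames E e -> atlas Q c' -> frames E e' ->
    open (cmap (adapted c e) @` (cdom (adapted c e) `&` cdom (adapted c' e'))).
  move=> Ac Fe Ac' Fe'; have ic := atlas_chart Ac; have ic' := atlas_chart Ac'.
  have fe := frames_frame Fe; have fe' := frames_frame Fe'.
  have -> : cdom (adapted c' e') = [set p | (cdom c' `&` fdom e') (base p)] by [].
  rewrite adapted_img //.
  apply: (@open_comp _ _ (qpart : _ -> 'rV[R]_n)
    (cmap c @` (cdom c `&` (fdom e `&` (cdom c' `&` fdom e'))))).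
    by move=> x _; exact: qpart_continuous.
  apply: chart_imgI_open => //.
  by do 2?[apply: openI]; [exact: frame_dom_open|exact: chart_dom_open|
    exact: frame_dom_open].
split.
- move=> _ _ [c [e [Ac Fe ->]]] [c' [e' [Ac' Fe' ->]]]; exact: img_open.
- move=> _ p [c [e [Ac Fe ->]]]; apply: adapted_mapK; first exact: atlas_chart.
  exact: frames_frame.
- move=> _ _ [c [e [Ac Fe ->]]] [c' [e' [Ac' Fe' ->]]] l.
  have ic := atlas_chart Ac; have ic' := atlas_chart Ac'.
  have fe := frames_frame Fe; have fe' := frames_frame Fe'.
  apply: smooth_on_at; first exact: img_open.
  move=> _ [p [[cp ep] [c'p e'p]] <-]; set x := cmap _ p.
  have qx : qpart x = cmap c (base p) by rewrite qpart_cmap.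
  elim/total_index: l => [i|a|].
  + apply: (@smooth_at_ext _ _ _
      (fun y => (fun z => cmap c' (cinv c z) 0 i) (qpart y))).
      by move=> y; rewrite adapted_iq.
    apply: (@smooth_at_comp _ _ _ (fun z => cmap c' (cinv c z) 0 i) qpart)
      => [|j]; last exact: qpart_smooth.
    by rewrite qx; exact: (transition_smooth sQ).
  + apply: (@smooth_at_eq _ _ _ (fun y => \sum_b y 0 (iy b) *
      (fun z => fco e' (fvec e (cinv c z) b) 0 a) (qpart y))).
      have nE : \forall y \near x, fdom e' (cinv c (qpart y)).
        apply: (continuous_nbhs (f := qpart) (B := [set z | fdom e' (cinv c z)]));
          first exact: qpart_continuous.
        have := iffRL (near_pt_nbhs (base p) (fdom e'))
          (open_nbhs_nbhs (conj (frame_dom_open fe') e'p)).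
        by move=> /(near_ptP sQ _ Ac cp); rewrite qx.
      apply: filterS nE => y ey; rewrite adapted_iy /ycoord /= fco_sum //.
      rewrite summxE; apply: eq_bigr => b _.
      by rewrite fcoZ // !mxE.
    have F b : smooth_at x (fun y => y 0 (iy b) *
      (fun z => fco e' (fvec e (cinv c z) b) 0 a) (qpart y)).
      apply: smooth_atM; first exact: smooth_at_coord.
      apply: (@smooth_at_comp _ _ _ (fun z => fco e' (fvec e (cinv c z) b) 0 a));
        last by move=> j; exact: qpart_smooth.
      rewrite qx; apply/(smooth_nearP sQ (fun q => fco e' (fvec e q b) 0 a) Ac cp).
      exact: (frames_smooth Fe).
    elim: (index_enum _) => [|b r IH].
      by apply: smooth_at_ext (smooth_at_cst x 0) => y; rewrite big_nil.
    by apply: smooth_at_ext (smooth_atD (F b) IH) => y; rewrite big_cons.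
  + apply: (@smooth_at_ext _ _ _ (fun y => y 0 i_s)); last exact: smooth_at_coord.
    by move=> y; rewrite adapted_is /scoord /= mxE.
Qed.

Lemma total_cover p : exists c e,
  [/\ atlas Q c, frames E e & cdom (adapted c e) p].
Proof.
have [c Ac cp] := atlas_cover (base p); have [e Fe ep] := frames_cover E (base p).
by exists c, e; split.
Qed.

Lemma adapted_total c e : atlas Q c -> frames E e -> total_atlas E (adapted c e).
Proof. by move=> Ac Fe; exists c, e. Qed.

Lemma near_base p (P : set Q) : (\forall q \near base p, P q) ->
  near_pt (total_atlas E) p [set p' | P (base p')].
Proof.
have sQ := @manifold_smooth_atlas R n Q.
have [c [e [Ac Fe [cp ep]]]] := total_cover p.
move=> /near_pt_nbhs/(near_ptP sQ _ Ac cp) nP.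
apply/(near_ptP total_smooth_atlas _ (adapted_total Ac Fe)) => //.
apply: (continuous_nbhs (f := qpart) (B := [set z | P (cinv c z)]));
  first exact: qpart_continuous.
by rewrite qpart_cmap.
Qed.

Lemma smooth_base p (f : Q -> R) : smooth_near (atlas Q) (base p) f ->
  smooth_near (total_atlas E) p (f \o @base _ _ _ _ E).
Proof.
have sQ := @manifold_smooth_atlas R n Q.
have [c [e [Ac Fe [cp ep]]]] := total_cover p.
move=> /(smooth_nearP sQ _ Ac cp) sf.
apply/(smooth_nearP total_smooth_atlas _ (adapted_total Ac Fe)) => //.
apply: (@smooth_at_comp _ _ _ (f \o cinv c) qpart); first by rewrite qpart_cmap.
by move=> i; exact: qpart_smooth.
Qed.

Lemma smooth_ycoord p e a : frames E e -> fdom e (base p) ->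
  smooth_near (total_atlas E) p (ycoord e a).
Proof.
move=> Fe ep; have [c Ac cp] := atlas_cover (base p).
have -> : ycoord e a = (fun p' => cmap (adapted c e) p' 0 (iy a)).
  by apply/funext => p'; rewrite adapted_iy.
by apply: (smooth_near_coord total_smooth_atlas) => //; exists c, e.
Qed.

Lemma smooth_scoord p : smooth_near (total_atlas E) p (@scoord _ _ _ _ E).
Proof.
have [c [e [Ac Fe cp]]] := total_cover p.
have -> : @scoord _ _ _ _ E = (fun p' => cmap (adapted c e) p' 0 i_s).
  by apply/funext => p'; rewrite adapted_is.
by apply: (smooth_near_coord total_smooth_atlas) => //; exists c, e.
Qed.

End Total.

(** * Local sections and structure functions of a Lie algebroid *)

Section Local.
Context {R : realType} {n m : nat} {Q : manifold R n} {E : vbundle Q m}.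
Implicit Types (q : Q) (e : frame m E) (s t : forall q, E q).

Let sQ := @manifold_smooth_atlas R n Q.

Lemma cutoff_out q U chi q' : cutoff q U chi -> ~ U q' -> chi q' = 0.
Proof. by move=> [_ _ chi0] /chi0/nbhs_singleton. Qed.

Lemma cutoff_self q U chi : cutoff q U chi -> chi q = 1.
Proof. by move=> [_ /nbhs_singleton]. Qed.

Lemma section_near_eq q s t : (\forall q' \near q, s q' = t q') ->
  section_smooth_near (frames E) q s -> section_smooth_near (frames E) q t.
Proof.
move=> st ss e Fe eq a; apply: (smooth_near_eq sQ _ (ss e Fe eq a)).
by apply/near_pt_nbhs; apply: filterS st => q' ->.
Qed.

Lemma section0_smooth q : section_smooth_near (frames E) q (fun q => 0).
Proof.
move=> e Fe eq a; have [c Ac cq] := atlas_cover q.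
have fe := frames_frame Fe.
apply: (smooth_near_eq sQ _ (smooth_near_cst sQ 0 Ac cq)).
apply/near_pt_nbhs.
apply: filterS (open_nbhs_nbhs (conj (frame_dom_open fe) eq)) => q' eq'.
by rewrite fco0 // mxE.
Qed.

Lemma sectionZ_smooth q f s : smooth_near (atlas Q) q f ->
  section_smooth_near (frames E) q s ->
  section_smooth_near (frames E) q (fun q' => f q' *: s q').
Proof.
move=> sf ss e Fe eq a; have fe := frames_frame Fe.
apply: (smooth_near_eq sQ _ (smooth_nearM sQ sf (ss e Fe eq a))).
apply/near_pt_nbhs.
apply: filterS (open_nbhs_nbhs (conj (frame_dom_open fe) eq)) => q' eq'.
by rewrite fcoZ // mxE.
Qed.

Lemma cut_section_smooth q U chi s : cutoff q U chi ->
  (forall q', U q' -> section_smooth_near (frames E) q' s) ->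
  smooth_section (E := E) (fun q' => chi q' *: s q').
Proof.
move=> [schi _ chi0] ss q'; have [Uq'|nU] := pselect (U q').
  by apply: sectionZ_smooth; [exact: schi|exact: ss].
apply: (@section_near_eq q' (fun=> 0)); last exact: section0_smooth.
by apply: filterS (chi0 _ nU) => q'' ->; rewrite scale0r.
Qed.

Lemma frame_extension e q a : frames E e -> fdom e q ->
  exists s, smooth_section s /\ \forall q' \near q, s q' = fvec e q' a.
Proof.
move=> Fe eq; have fe := frames_frame Fe.
have [chi hchi] := cutoff_exists (frame_dom_open fe) eq.
exists (fun q' => chi q' *: fvec e q' a); split.
  by apply: cut_section_smooth hchi _ => q' eq'; exact: frames_smooth.
by have [_ + _] := hchi; apply: filterS => q' ->; rewrite scale1r.
Qed.

Variable A : lie_algebroid E.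

(** By the Leibniz rule, multiplying a section by a cut-off changes the bracket
    at the centre of the cut-off only by a term that depends on the value of the
    section there, and it makes two sections with the same germ equal. *)
Lemma bracket_local q s s' t t' :
  smooth_section s -> smooth_section s' -> smooth_section t -> smooth_section t' ->
  (\forall q' \near q, s q' = s' q') -> (\forall q' \near q, t q' = t' q') ->
  bracket A s t q = bracket A s' t' q.
Proof.
have right u v v' : smooth_section u -> smooth_section v -> smooth_section v' ->
    (\forall q' \near q, v q' = v' q') -> bracket A u v q = bracket A u v' q.
  move=> su sv sv' vv'; have : nbhs q [set q' | v q' = v' q'] by [].
  rewrite nbhsE => -[U [oU Uq] Uvv'].
  have [chi hchi] := cutoff_exists oU Uq; have [schi _ _] := hchi.
  have E1 := br_leibniz (bracketP A) su sv schi q.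
  have E2 := br_leibniz (bracketP A) su sv' schi q.
  have chiE : (fun q' => chi q' *: v q') = (fun q' => chi q' *: v' q').
    apply: functional_extensionality_dep => q'.
    have [Uq'|nU] := pselect (U q'); first by rewrite Uvv'.
    by rewrite (cutoff_out hchi nU) !scale0r.
  move: E1; rewrite chiE E2 (cutoff_self hchi) !scale1r.
  by rewrite -(nbhs_singleton vv') => /addIr.
move=> ss ss' st st' ss'E tt'E.
rewrite (right _ _ _ ss st st' tt'E) (br_anti (bracketP A) ss st').
by rewrite (right _ _ _ st' ss ss' ss'E) -(br_anti (bracketP A) ss' st').
Qed.

(** The bracket of any two global extensions may serve to define the structure
    functions at a point; near a given point one choice of extensions serves all
    points, whence the smoothness. *)
Lemma structure_functions_exist e : frames E e ->
  exists2 C, structure_functions A e C & forall q, fdom e q ->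
    forall g a b, smooth_near (atlas Q) q (C g a b).
Proof.
move=> Fe; have fe := frames_frame Fe.
have : forall qa : Q * 'I_m, exists s : forall q, E q, fdom e qa.1 ->
    smooth_section s /\ \forall q' \near qa.1, s q' = fvec e q' qa.2.
  move=> [q a]; have [eq|neq] := pselect (fdom e q).
    by have [s sP] := frame_extension a Fe eq; exists s.
  by exists (fun=> 0).
move=> /choice[S SP].
pose C g a b q := fco e (bracket A (S (q, a)) (S (q, b)) q) 0 g.
have SCE (q : Q) (a b : 'I_m) s t : fdom e q -> smooth_section s -> smooth_section t ->
    (\forall q' \near q, s q' = fvec e q' a) ->
    (\forall q' \near q, t q' = fvec e q' b) ->
    bracket A s t q = bracket A (S (q, a)) (S (q, b)) q.
  move=> eq ss st sE tE.
  have [sa aE] := SP (q, a) eq; have [sb bE] := SP (q, b) eq.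
  apply: bracket_local => //.
    by apply: filterS2 sE aE => q' -> ->.
  by apply: filterS2 tE bE => q' -> ->.
exists C.
  move=> q eq a b s t ss st sE tE; rewrite (SCE q a b) //.
  by rewrite -[LHS](frame_vecK fe eq).
move=> q eq g a b.
have [sa aE] := SP (q, a) eq; have [sb bE] := SP (q, b) eq.
have := br_closed (bracketP A) sa sb q e Fe eq g.
apply: (smooth_near_eq sQ); apply/near_pt_nbhs.
have eqn := open_nbhs_nbhs (conj (frame_dom_open fe) eq).
apply: filterS3 (nbhs_interior aE) (nbhs_interior bE) eqn => q' aE' bE' eq'.
by rewrite /C (SCE q' a b _ _ eq' sa sb aE' bE').
Qed.

Lemma structure_functions_anti e C q g a b : frames E e ->
  structure_functions A e C -> fdom e q -> C g a b q = - C g b a q.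
Proof.
move=> Fe hC eq; have fe := frames_frame Fe.
have [s [ss sE]] := frame_extension a Fe eq.
have [t [st tE]] := frame_extension b Fe eq.
have CE c d u v : smooth_section u -> smooth_section v ->
    (\forall q' \near q, u q' = fvec e q' c) ->
    (\forall q' \near q, v q' = fvec e q' d) ->
    C g c d q = fco e (bracket A u v q) 0 g.
  move=> su sv uE vE; rewrite (hC q eq c d u v su sv uE vE).
  have -> : \sum_g C g c d q *: fvec e q g
      = \sum_g (\row_g C g c d q) 0 g *: fvec e q g.
    by apply: eq_bigr => l _; rewrite mxE.
  by rewrite frame_coK // mxE.
rewrite (CE a b s t) // (CE b a t s) // (br_anti (bracketP A) ss st).
by rewrite -scaleN1r fcoZ // mxE mulN1r.
Qed.

End Local.

(** * The fibres of the prolongation *)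

Section Fibres.
Context {R : realType} {n m : nat} {Q : manifold R n} {E : vbundle Q m}.
Variable A : lie_algebroid E.
Implicit Types (c : chart R Q n) (e : frame m E) (p : ExR E).

Let sQ := @manifold_smooth_atlas R n Q.
Let sT := @total_smooth_atlas R n m Q E.
Local Notation smoothT := (smooth_near (total_atlas E)).

Lemma prol_fibre_linear p (k : R) (z z' : prol p) :
  prol_fibre A z -> prol_fibre A z' -> prol_fibre A (k *: z + z').
Proof.
move=> [tz zE] [tz' z'E]; split; first exact: (tangent_linear sT).
move=> f sf; rewrite (anchor_linear A k z.1 z'.1).
by rewrite !fctE /= zE // z'E.
Qed.

Lemma tangent0 p : tangent (total_atlas E) p 0.
Proof.
have [c [e [Ac Fe cp]]] := total_cover p.
have Ace := adapted_total Ac Fe.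
exists (adapted c e), 0; split=> //; apply/funext => f.
have [sf|sf] := pselect (smoothT p f); last by rewrite coord_vec0.
by rewrite (coord_vecE sT) // big1 // => i _; rewrite mxE mul0r.
Qed.

Lemma anchor0 q f : anchor A (0 : E q) f = 0.
Proof.
have := anchor_linear A (-1) (0 : E q) 0; rewrite scaleN1r oppr0 addr0 scaleN1r addNr.
by move=> ->.
Qed.

Lemma prol_fibre0 p : prol_fibre A (0 : prol p).
Proof. by split; [exact: tangent0|move=> f _; rewrite anchor0]. Qed.

Lemma prol_fibreZ p (k : R) (z : prol p) : prol_fibre A z -> prol_fibre A (k *: z).
Proof. by move=> zA; rewrite -[_ *: _]addr0; exact/prol_fibre_linear/prol_fibre0. Qed.

Lemma pdual_linear e p k : frames E e -> fdom e (base p) ->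
  linear (@pdual _ _ _ _ E e k p).
Proof.
move=> Fe ep x z z'; case: k => [a|a|] //=.
by rewrite (fco_linear (frames_frame Fe) ep) !mxE.
Qed.

Section InChart.
Variables (c : chart R Q n) (e : frame m E).
Hypotheses (Ac : atlas Q c) (Fe : frames E e).

Let Ace : total_atlas E (adapted c e) := adapted_total Ac Fe.
Let fe := frames_frame Fe.

Lemma anchor_sum q (b : E q) f : cdom c q -> smooth_near (atlas Q) q f ->
  anchor A b f = \sum_i anchor A b (fun x => cmap c x 0 i) * pder c i f q.
Proof.
move=> cq sf.
by apply: (tangent_sum sQ) => //; exact: anchor_tangent.
Qed.

Lemma anchor_frame q (b : E q) f : fdom e q ->
  anchor A b f = \sum_a fco e b 0 a * anchor A (fvec e q a) f.
Proof.
move=> eq; rewrite -{1}(frame_vecK fe eq b).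
elim: (index_enum _) => [|a r IH]; first by rewrite !big_nil anchor0.
by rewrite !big_cons (anchor_linear A) !fctE IH.
Qed.

(** [f \o base] reads [f \o cinv c \o qpart] in the adapted chart. *)
Lemma pder_base j (f : Q -> R) p : cdom (adapted c e) p ->
  smooth_near (atlas Q) (base p) f ->
  pder (adapted c e) j (f \o @base _ _ _ _ E) p =
  \sum_i (j == iq i)%:R * pder c i f (base p).
Proof.
move=> [cp ep] sf; rewrite /pder.
have df : differentiable (f \o cinv c) (qpart (cmap (adapted c e) p)).
  by rewrite qpart_cmap; exact/smooth_at_differentiable/(smooth_nearP sQ _ Ac cp).
have dq (x v : 'rV[R]_(n + m + 1)) i : is_derive x v (fun y => qpart y 0 i) (v 0 (iq i)).
  have -> : (fun y => qpart y 0 i) = (fun y : 'rV[R]_(n + m + 1) => y 0 (iq i)).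
    by apply/funext => y; rewrite qpartE.
  exact: is_derive_coord.
have dqd i : derivable (fun y => qpart y 0 i) (cmap (adapted c e) p) (evec j).
  by case: (dq (cmap (adapted c e) p) (evec j) i).
have [_ H] := is_derive_chain df dqd.
rewrite [LHS]H; apply: eq_bigr => i _.
have [_ ->] := dq (cmap (adapted c e) p) (evec j) i.
by rewrite mxE /= qpart_cmap eq_sym.
Qed.

End InChart.
End Fibres.

Definition pindices (m : nat) : seq (@pindex m) :=
  [seq PX a | a <- index_enum 'I_m] ++
  ([seq PV a | a <- index_enum 'I_m] ++ [:: @PS m]).

Lemma pindices_sum (m : nat) (V : nmodType) (F : @pindex m -> V) :
  \sum_(k <- pindices m) F k =
  \sum_a F (PX a) + (\sum_a F (PV a) + F (@PS m)).
Proof. by rewrite !big_cat !big_map big_seq1. Qed.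

Lemma sum_evec (R : realType) (k : nat) (i : 'I_k) (F : 'I_k -> R) :
  \sum_j (evec i : 'rV[R]_k) 0 j * F j = F i.
Proof.
rewrite (bigD1 i) //= big1 ?addr0; first by rewrite mxE !eqxx mul1r.
by move=> j ji; rewrite mxE (negPf ji) andbF mul0r.
Qed.

Lemma sum_comb_evec (R : realType) (k l : nat) (a : 'I_l -> R)
    (idx : 'I_l -> 'I_k) (F : 'I_k -> R) :
  \sum_j (\sum_i a i *: evec (idx i) : 'rV[R]_k) 0 j * F j
  = \sum_i a i * F (idx i).
Proof.
under eq_bigr => j _ do rewrite summxE mulr_suml.
rewrite exchange_big /=; apply: eq_bigr => i _.
rewrite -(sum_evec (idx i) F) mulr_sumr.
by apply: eq_bigr => j _; rewrite mxE mulrA.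
Qed.

Section FibresInChart.
Context {R : realType} {n m : nat} {Q : manifold R n} {E : vbundle Q m}.
Variable A : lie_algebroid E.
Variables (c : chart R Q n) (e : frame m E).
Hypotheses (Ac : atlas Q c) (Fe : frames E e).

Let sQ := @manifold_smooth_atlas R n Q.
Let sT := @total_smooth_atlas R n m Q E.
Local Notation smoothT := (smooth_near (total_atlas E)).
Let Ace : total_atlas E (adapted c e) := adapted_total Ac Fe.
Let fe := frames_frame Fe.
Implicit Types (p : ExR E) (f L : ExR E -> R).

(** The action of the [k]-th basis section on functions, without the smoothness
    test that is built into [coord_vec]. *)
Definition bder (k : @pindex m) (f : ExR E -> R) (p : ExR E) : R :=
  match k with
  | PX a => \sum_i anchor_coef A c e i a (base p) * pder (adapted c e) (iq i) f p
  | PV a => pder (adapted c e) (iy a) f p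
  | PS => pder (adapted c e) i_s f p
  end.

Lemma panchor_basis k p f : cdom (adapted c e) p -> smoothT p f ->
  panchor (pbasis A c e k p) f = bder k f p.
Proof.
move=> cp sf; case: k => [a|a|] /=; rewrite /panchor /= (coord_vecE sT) //;
  try exact: (sum_evec _ (fun j => pder (adapted c e) j f p)).
exact: (sum_comb_evec _ _ (fun j => pder (adapted c e) j f p)).
Qed.

Lemma bder_smooth k p f : cdom (adapted c e) p -> smoothT p f ->
  smoothT p (bder k f).
Proof.
move=> cp sf; case: k => [a|a|]; rewrite /bder;
  try exact: (smooth_near_pder sT).
refine (@smooth_near_sum _ _ _ _ sT _ p _ (index_enum 'I_n) xpredT
  (fun i p' => anchor_coef A c e i a (base p') * pder (adapted c e) (iq i) f p')
  Ace cp _) => i _.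
apply: (smooth_nearM sT); last exact: (smooth_near_pder sT).
by case: cp => cp ep; apply: smooth_base; exact: anchor_smooth.
Qed.

Lemma pder_adapted p i j : cdom (adapted c e) p ->
  pder (adapted c e) i (fun p' => cmap (adapted c e) p' 0 j) p = (i == j)%:R.
Proof. by move=> cp; rewrite (pder_coord sT). Qed.

Lemma pder_ycoord p i a : cdom (adapted c e) p ->
  pder (adapted c e) i (ycoord e a) p = (i == iy a)%:R.
Proof.
move=> cp; have <- : (fun p' => cmap (adapted c e) p' 0 (iy a)) = ycoord e a.
  by apply/funext => p'; rewrite adapted_iy.
exact: pder_adapted.
Qed.

Lemma pder_scoord p i : cdom (adapted c e) p ->
  pder (adapted c e) i (@scoord _ _ _ _ E) p = (i == i_s)%:R.
Proof.
move=> cp.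
have <- : (fun p' => cmap (adapted c e) p' 0 i_s) = @scoord _ _ _ _ E.
  by apply/funext => p'; rewrite adapted_is.
exact: pder_adapted.
Qed.

Definition pdelta (k l : @pindex m) : R :=
  match k, l with
  | PX a, PX b => (a == b)%:R
  | PV a, PV b => (a == b)%:R
  | PS, PS => 1
  | _, _ => 0
  end.

Lemma sum_pdelta (F : @pindex m -> R) l :
  \sum_(k <- pindices m) F k * pdelta l k = F l.
Proof.
have dl (G : 'I_m -> R) (b : 'I_m) : \sum_a G a * (b == a)%:R = G b.
  rewrite (bigD1 b) //= big1 ?addr0 ?eqxx ?mulr1 // => a ab.
  by rewrite eq_sym (negPf ab) mulr0.
have z0 (G : 'I_m -> R) : \sum_a G a * 0 = 0 by rewrite big1 // => a _; rewrite mulr0.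
by rewrite pindices_sum; case: l => [b|b|] /=;
  rewrite ?dl ?z0 ?mulr0 ?mulr1 ?add0r ?addr0.
Qed.

Lemma bder_ycoord k p a : cdom (adapted c e) p ->
  bder k (ycoord e a) p = pdelta (PV a) k.
Proof.
move=> cp; case: k => [b|b|] /=; rewrite ?pder_ycoord //.
- by rewrite big1 // => i _; rewrite pder_ycoord // /iq /iy eq_lshift eq_lrshift mulr0.
- by rewrite /iy eq_lshift eq_rshift eq_sym.
- by rewrite /i_s /iy eq_rlshift.
Qed.

Lemma bder_scoord k p : cdom (adapted c e) p ->
  bder k (@scoord _ _ _ _ E) p = pdelta (@PS m) k.
Proof.
move=> cp; case: k => [b|b|] /=; rewrite ?pder_scoord ?eqxx //.
- by rewrite big1 // => i _; rewrite pder_scoord // /iq /i_s eq_lrshift mulr0.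
- by rewrite /iy /i_s eq_lrshift.
Qed.

Lemma pdual_basis k l p : cdom (adapted c e) p ->
  pdual e l (pbasis A c e k p) = pdelta l k.
Proof.
move=> cp; have [_ ep] := cp.
have pa f : smoothT p f -> (pbasis A c e k p).2 f = bder k f p.
  exact: panchor_basis.
case: l => [b|b|] /=.
- case: k pa => [a|a|] _ /=; rewrite ?(fco_vec fe ep) ?(fco0 fe ep) !mxE ?eqxx //=.
- by rewrite pa ?bder_ycoord //; exact: smooth_ycoord.
- by rewrite pa ?bder_scoord //; exact: smooth_scoord.
Qed.

Lemma bder_base k p (f : Q -> R) : cdom (adapted c e) p ->
  smooth_near (atlas Q) (base p) f ->
  bder k (f \o @base _ _ _ _ E) p =
  if k is PX a then anchor A (fvec e (base p) a) f else 0.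
Proof.
move=> cp sf; have [cq eq] := cp.
have sb := smooth_base sf.
case: k => [a|a|] /=.
- rewrite (anchor_sum A Ac (fvec e (base p) a) cq sf); apply: eq_bigr => i _.
  rewrite (pder_base Ac) //; congr (_ * _).
  rewrite (bigD1 i) //= big1 ?addr0 ?eqxx ?mul1r // => j ji.
  by rewrite /iq !eq_lshift eq_sym (negPf ji) mul0r.
- rewrite (pder_base Ac) // big1 // => i _.
  by rewrite /iy /iq eq_lshift eq_rlshift mul0r.
- by rewrite (pder_base Ac) // big1 // => i _; rewrite eq_rlshift mul0r.
Qed.

Lemma pbasis_fibre k p : cdom (adapted c e) p -> prol_fibre A (pbasis A c e k p).
Proof.
move=> cp; split; first by case: k => [a|a|]; exact: coord_vec_tangent.
move=> f sf; have := panchor_basis k cp (smooth_base sf).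
rewrite /panchor => ->; rewrite bder_base //.
by case: k => [a|a|] //=; rewrite anchor0.
Qed.

(** The [q]-components of the tangent vector are determined by the element of
    [E], because an element of the fibre is compatible with the anchor. *)
Lemma prol_ext p (z z' : prol p) : cdom (adapted c e) p ->
  prol_fibre A z -> prol_fibre A z' ->
  (forall k, pdual e k z = pdual e k z') -> z = z'.
Proof.
move=> cp [tz zE] [tz' z'E] zz'; have [cq eq] := cp.
have z1 : z.1 = z'.1.
  by apply: (fco_inj fe eq); apply/rowP => a; exact: (zz' (PX a)).
suff z2 : z.2 = z'.2 by case: z z' z1 z2 {tz zE tz' z'E zz'} => ? ? [? ?] /= -> ->.
rewrite (tangentE sT tz Ace cp) (tangentE sT tz' Ace cp); congr coord_vec.
apply/rowP; apply: total_index => [i|a|]; rewrite !mxE.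
- have iE : (fun p' => cmap (adapted c e) p' 0 (iq i))
      = (fun q => cmap c q 0 i) \o @base _ _ _ _ E.
    by apply/funext => p'; rewrite adapted_iq.
  have sc : smooth_near (atlas Q) (base p) (fun q => cmap c q 0 i).
    exact: (smooth_near_coord sQ).
  by rewrite iE -zE // -z'E // z1.
- have -> : (fun p' => cmap (adapted c e) p' 0 (iy a)) = ycoord e a.
    by apply/funext => p'; rewrite adapted_iy.
  exact: (zz' (PV a)).
- have -> : (fun p' => cmap (adapted c e) p' 0 i_s) = @scoord _ _ _ _ E.
    by apply/funext => p'; rewrite adapted_is.
  exact: (zz' (@PS m)).
Qed.

Lemma prol_fibre_sum p (I : Type) (r : seq I) (F : I -> prol p) :
  (forall i, prol_fibre A (F i)) -> prol_fibre A (\sum_(i <- r) F i).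
Proof.
move=> FA; elim: r => [|i r IH]; first by rewrite big_nil; exact: prol_fibre0.
by rewrite big_cons -[F i]scale1r; exact: prol_fibre_linear.
Qed.

Lemma pdualD p k (z z' : prol p) : fdom e (base p) ->
  pdual e k (z + z') = pdual e k z + pdual e k z'.
Proof.
by move=> ep; rewrite -[z in LHS]scale1r (pdual_linear k Fe ep) scale1r.
Qed.

Lemma pdual0 p k : fdom e (base p) -> pdual e k (0 : prol p) = 0.
Proof.
move=> ep; have := pdual_linear k Fe ep (-1) 0 0.
by rewrite scaleN1r oppr0 addr0 scaleN1r addNr.
Qed.

Lemma pdualZ p k (a : R) (z : prol p) : fdom e (base p) ->
  pdual e k (a *: z) = a * pdual e k z.
Proof.
by move=> ep; rewrite -[a *: z]addr0 (pdual_linear k Fe ep) pdual0 // addr0.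
Qed.

Lemma pdual_sum p k (I : Type) (r : seq I) (F : I -> prol p) : fdom e (base p) ->
  pdual e k (\sum_(i <- r) F i) = \sum_(i <- r) pdual e k (F i).
Proof.
move=> ep; elim: r => [|i r IH]; first by rewrite !big_nil pdual0.
by rewrite !big_cons pdualD // IH.
Qed.

Lemma pdual_comb p (F : @pindex m -> R) k : cdom (adapted c e) p ->
  pdual e k (\sum_(l <- pindices m) F l *: pbasis A c e l p) = F k.
Proof.
move=> cp; have [_ ep] := cp; rewrite pdual_sum // -[RHS]sum_pdelta.
by apply: eq_bigr => l _; rewrite pdualZ // pdual_basis.
Qed.

Lemma comb_fibre p (F : @pindex m -> R) : cdom (adapted c e) p ->
  prol_fibre A (\sum_(l <- pindices m) F l *: pbasis A c e l p).
Proof.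
by move=> cp; apply: prol_fibre_sum => l; apply: prol_fibreZ; exact: pbasis_fibre.
Qed.

Lemma prol_expand p (z : prol p) : cdom (adapted c e) p -> prol_fibre A z ->
  z = \sum_(k <- pindices m) pdual e k z *: pbasis A c e k p.
Proof.
move=> cp zA; apply: prol_ext => //; first exact: comb_fibre.
by move=> k; rewrite pdual_comb.
Qed.

Lemma panchor_sum p (I : Type) (r : seq I) (F : I -> prol p) f :
  panchor (\sum_(i <- r) F i) f = \sum_(i <- r) panchor (F i) f.
Proof.
elim: r => [|i r IH]; first by rewrite !big_nil.
by rewrite !big_cons -IH.
Qed.

Lemma panchor_expand p (z : prol p) f : cdom (adapted c e) p -> prol_fibre A z ->
  smoothT p f -> panchor z f = \sum_(k <- pindices m) pdual e k z * bder k f p.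
Proof.
move=> cp zA sf; rewrite {1}(prol_expand cp zA) panchor_sum.
by apply: eq_bigr => k _; rewrite -panchor_basis.
Qed.

(** The curve [vel p + t *: b] is a straight line in the adapted chart. *)
Lemma vliftE p (b : E (base p)) f : cdom (adapted c e) p -> smoothT p f ->
  vlift b f = \sum_a fco e b 0 a * pder (adapted c e) (iy a) f p.
Proof.
move=> cp sf; rewrite /vlift asboolT //; have [cq eq] := cp.
pose w : 'rV[R]_(n + m + 1) := \sum_a fco e b 0 a *: evec (iy a).
have wE : coord_vec (total_atlas E) (adapted c e) p w f =
    \sum_a fco e b 0 a * pder (adapted c e) (iy a) f p.
  rewrite (coord_vecE sT) //.
  exact: (sum_comb_evec _ _ (fun j => pder (adapted c e) j f p)).
rewrite -wE /coord_vec asboolT // derive1E.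
have wj j : w 0 j = \sum_a fco e b 0 a * (j == iy a)%:R.
  by rewrite summxE; apply: eq_bigr => a _; rewrite mxE mxE.
have lineE (t : R) : pt (vel p + t *: b) p.2
    = cinv (adapted c e) (t *: w + cmap (adapted c e) p).
  set p' := pt _ _; have cp' : cdom (adapted c e) p' by [].
  rewrite -[LHS](sa_mapK sT Ace cp'); congr cinv.
  apply/rowP; apply: total_index => [i|a|].
  - rewrite adapted_iq [RHS]mxE adapted_iq mxE wj big1 ?mulr0 ?add0r //.
    by move=> a _; rewrite /iq /iy eq_lshift eq_lrshift mulr0.
  - rewrite adapted_iy [RHS]mxE adapted_iy mxE wj.
    rewrite {1}/ycoord (fcoD fe eq) (fcoZ fe eq) !mxE addrC; congr (_ * _ + _).
    rewrite (bigD1 a) //= eqxx mulr1 big1 ?addr0 // => d da.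
    by rewrite /iy eq_lshift eq_rshift eq_sym (negPf da) mulr0.
  - rewrite adapted_is [RHS]mxE adapted_is mxE wj big1 ?mulr0 ?add0r //.
    by move=> a _; rewrite /i_s /iy eq_rlshift mulr0.
have -> : (fun t : R => f (pt (vel p + t *: b) p.2)) =
    (fun t => (f \o cinv (adapted c e)) (t *: w + cmap (adapted c e) p)).
  by apply/funext => t; rewrite lineE.
by rewrite (derive_line (f \o cinv (adapted c e))) scale0r add0r.
Qed.

Lemma etaE L p (z : prol p) : cdom (adapted c e) p -> smoothT p L ->
  eta L z = pdual e (@PS m) z
    - \sum_a pdual e (PX a) z * pder (adapted c e) (iy a) L p.
Proof. by move=> cp sL; rewrite /eta /Theta /panchor /= vliftE. Qed.

Lemma energyE L p : cdom (adapted c e) p -> smoothT p L ->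
  energy L p = \sum_a ycoord e a p * pder (adapted c e) (iy a) L p - L p.
Proof. by move=> cp sL; rewrite /energy /panchor /= vliftE. Qed.

End FibresInChart.

(** * Smooth sections of the prolongation *)

Section PSections.
Context {R : realType} {n m : nat} {Q : manifold R n} {E : vbundle Q m}.
Variable A : lie_algebroid E.
Implicit Types (c : chart R Q n) (e : frame m E) (p : ExR E) (Z W : psection E).

Let sQ := @manifold_smooth_atlas R n Q.
Let sT := @total_smooth_atlas R n m Q E.
Local Notation smoothT := (smooth_near (total_atlas E)).
Local Notation nearT := (near_pt (total_atlas E)).

(** The pointwise form of [smooth_psection], for sections such as the basis
    sections that are meaningful over a chart only. *)
Definition psmooth Z p : Prop := prol_fibre A (Z p) /\
  forall e, frames E e -> fdom e (base p) -> forall k,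
    smoothT p (fun p' => pdual e k (Z p')).

Lemma smooth_psectionP Z : smooth_psection A Z <-> forall p, psmooth Z p.
Proof.
split=> [[ZA Zs] p|H]; first by split=> // e Fe ep k; exact: Zs.
by split=> [p|e Fe p ep k]; have [ZA Zs] := H p; [exact: ZA|exact: Zs].
Qed.

Lemma near_fdom e p : frames E e -> fdom e (base p) ->
  nearT p (fun p' => fdom e (base p')).
Proof.
move=> Fe ep; apply: near_base; apply: open_nbhs_nbhs; split=> //.
exact/frame_dom_open/frames_frame.
Qed.

Lemma smoothT_cst p (a : R) : smoothT p (fun=> a).
Proof.
have [c [e [Ac Fe cp]]] := total_cover p.
exact: (smooth_near_cst sT a (adapted_total Ac Fe) cp).
Qed.

Lemma psmooth_near_eq Z W p : nearT p (fun p' => Z p' = W p') ->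
  psmooth Z p -> psmooth W p.
Proof.
move=> ZW [ZA Zs]; split; first by rewrite -(near_pt_self sT ZW).
move=> e Fe ep k; apply: (smooth_near_eq sT _ (Zs e Fe ep k)).
by apply: near_ptS ZW => p' ->.
Qed.

Lemma psmooth_linear f Z W p : smoothT p f -> psmooth Z p -> psmooth W p ->
  psmooth (fun p' => f p' *: Z p' + W p') p.
Proof.
move=> sf [ZA Zs] [WA Ws]; split; first exact: prol_fibre_linear.
move=> e Fe ep k.
apply: (smooth_near_eq sT _
  (smooth_nearD sT (smooth_nearM sT sf (Zs e Fe ep k)) (Ws e Fe ep k))).
by apply: near_ptS (near_fdom Fe ep) => p' ep'; rewrite (pdual_linear k Fe ep').
Qed.

Lemma psmooth0 p : psmooth (fun=> 0) p.
Proof.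
split; first exact: prol_fibre0.
move=> e Fe ep k; apply: (smooth_near_eq sT _ (smoothT_cst p 0)).
by apply: near_ptS (near_fdom Fe ep) => p' ep'; rewrite (pdual0 Fe).
Qed.

Lemma psmoothZ f Z p : smoothT p f -> psmooth Z p ->
  psmooth (fun p' => f p' *: Z p') p.
Proof.
move=> sf sZ; apply: psmooth_near_eq (psmooth_linear sf sZ (psmooth0 p)).
have [c [e [Ac Fe cp]]] := total_cover p.
apply: near_ptS (near_pt_chart sT (adapted_total Ac Fe) cp) => p' _.
by rewrite addr0.
Qed.

Lemma psmooth_sum (I : Type) (r : seq I) (f : I -> ExR E -> R)
    (Z : I -> psection E) p :
  (forall i, smoothT p (f i)) -> (forall i, psmooth (Z i) p) ->
  psmooth (fun p' => \sum_(i <- r) f i p' *: Z i p') p.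
Proof.
move=> sf sZ; elim: r => [|i r IH].
  have -> : (fun p' => \sum_(i <- [::]) f i p' *: Z i p') = (fun=> 0).
    by apply: functional_extensionality_dep => p'; rewrite big_nil.
  exact: psmooth0.
have -> : (fun p' => \sum_(i <- i :: r) f i p' *: Z i p') =
    (fun p' => f i p' *: Z i p' + \sum_(i <- r) f i p' *: Z i p').
  by apply: functional_extensionality_dep => p'; rewrite big_cons.
exact: psmooth_linear.
Qed.

Lemma psmooth_basis c e k p : atlas Q c -> frames E e -> cdom (adapted c e) p ->
  psmooth (pbasis A c e k) p.
Proof.
move=> Ac Fe cp; have [cq eq] := cp; have Ace := adapted_total Ac Fe.
split; first exact: pbasis_fibre.
move=> e' Fe' eq' l.
have nchart := near_pt_chart sT Ace cp.
have anch f : smoothT p f -> smoothT p (fun p' => (pbasis A c e k p').2 f).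
  move=> sf; apply: (smooth_near_eq sT _ (bder_smooth A Ac Fe k cp sf)).
  apply: near_ptS (near_ptI sT nchart (smooth_near_near sT sf)) => p' [cp' sf'].
  by rewrite -(panchor_basis A Ac Fe k cp' sf').
case: l => [b|b|] /=.
- case: k {anch} => [a|a|] /=.
  + apply: (smooth_base (f := fun q => fco e' (fvec e q a) 0 b)).
    exact: (frames_smooth Fe).
  + apply: (smooth_near_eq sT _ (smoothT_cst p 0)).
    apply: near_ptS (near_fdom Fe' eq') => p' ep'.
    by rewrite (fco0 (frames_frame Fe') ep') mxE.
  + apply: (smooth_near_eq sT _ (smoothT_cst p 0)).
    apply: near_ptS (near_fdom Fe' eq') => p' ep'.
    by rewrite (fco0 (frames_frame Fe') ep') mxE.
- by apply: anch; exact: smooth_ycoord.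
- by apply: anch; exact: smooth_scoord.
Qed.

Lemma cut_fun_smooth q U chi f : cutoff q U chi ->
  (forall p, U (base p) -> smoothT p f) ->
  smooth_fun (total_atlas E) (fun p => chi (base p) * f p).
Proof.
move=> [schi _ chi0] sf p; have [Up|nU] := pselect (U (base p)).
  by apply: (smooth_nearM sT); [apply: smooth_base; exact: schi|exact: sf].
apply: (smooth_near_eq sT _ (smoothT_cst p 0)).
by apply: near_ptS (near_base (chi0 _ nU)) => p' /= ->; rewrite mul0r.
Qed.

Lemma cut_psection_smooth q U chi Z : cutoff q U chi ->
  (forall p, U (base p) -> psmooth Z p) ->
  smooth_psection A (fun p => chi (base p) *: Z p).
Proof.
move=> [schi _ chi0] sZ; apply/smooth_psectionP => p.
have [Up|nU] := pselect (U (base p)).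
  by apply: psmoothZ; [apply: smooth_base; exact: schi|exact: sZ].
apply: psmooth_near_eq (psmooth0 p).
by apply: near_ptS (near_base (chi0 _ nU)) => p' /= ->; rewrite scale0r.
Qed.

Lemma psection_tangent Z p : smooth_psection A Z ->
  tangent (total_atlas E) p (panchor (Z p)).
Proof. by move=> [/(_ p)[]]. Qed.

Section WithLagrangian.
Variable L : ExR E -> R.
Hypothesis hL : smooth_fun (total_atlas E) L.

Lemma eta_linear p : linear (@eta _ _ _ _ E L p).
Proof.
have [c [e [Ac Fe cp]]] := total_cover p; have [_ ep] := cp.
move=> a z z'; rewrite !(etaE Ac Fe _ cp) // !(pdual_linear _ Fe ep).
under eq_bigr => i _ do rewrite (pdual_linear _ Fe ep) mulrDl -mulrA.
rewrite big_split /= -mulr_sumr /GRing.scale /=; ring.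
Qed.

Lemma etaZ p (a : R) (z : prol p) : eta L (a *: z) = a * eta L z.
Proof.
have e0 : eta L (0 : prol p) = 0.
  by have := eta_linear (-1) (0 : prol p) 0; rewrite scaleN1r oppr0 addr0 scaleN1r addNr.
by have := eta_linear a z 0; rewrite addr0 e0 addr0.
Qed.

Lemma etaD p (z z' : prol p) : eta L (z + z') = eta L z + eta L z'.
Proof. by have := eta_linear 1 z z'; rewrite !scale1r. Qed.

Lemma etaN p (z : prol p) : eta L (- z) = - eta L z.
Proof. by rewrite -scaleN1r etaZ mulN1r. Qed.

Lemma eta_sum p (I : Type) (r : seq I) (F : I -> prol p) :
  eta L (\sum_(i <- r) F i) = \sum_(i <- r) eta L (F i).
Proof.
elim: r => [|i r IH]; last by rewrite !big_cons etaD IH.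
by rewrite !big_nil -[0 in LHS](scale0r (0 : prol p)) etaZ mul0r.
Qed.

Lemma eta_smooth Z p : smooth_psection A Z -> smoothT p (fun p' => eta L (Z p')).
Proof.
move=> [ZA Zs]; have [c [e [Ac Fe cp]]] := total_cover p.
have Ace := adapted_total Ac Fe; have [cq eq] := cp.
have : smoothT p (fun p' => pdual e (@PS m) (Z p')
    - \sum_a pdual e (PX a) (Z p') * pder (adapted c e) (iy a) L p').
  apply: (smooth_nearD sT); first exact: Zs.
  apply: (smooth_nearN sT).
  refine (@smooth_near_sum _ _ _ _ sT _ p _ (index_enum 'I_m) xpredT
    (fun a p' => pdual e (PX a) (Z p') * pder (adapted c e) (iy a) L p')
    Ace cp _) => a _.
  by apply: (smooth_nearM sT); [exact: Zs|exact: (smooth_near_pder sT)].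
apply: (smooth_near_eq sT).
by apply: near_ptS (near_pt_chart sT Ace cp) => p' cp'; rewrite (etaE Ac Fe).
Qed.

Variable P : prolongation A.

(** ** The exterior differential of [eta] is tensorial *)

Lemma pd1_anti Z W p : smooth_psection A Z -> smooth_psection A W ->
  pd1 P (eta L) Z W p = - pd1 P (eta L) W Z p.
Proof.
move=> sZ sW; rewrite /pd1 (br_anti (pbracketP P) sZ sW) etaN; ring.
Qed.

Lemma pd1D Z Z' W p : smooth_psection A Z -> smooth_psection A Z' ->
  smooth_psection A W ->
  pd1 P (eta L) (fun p' => Z p' + Z' p') W p =
  pd1 P (eta L) Z W p + pd1 P (eta L) Z' W p.
Proof.
move=> sZ sZ' sW; rewrite /pd1.
have := br_linear (pbracketP P) 1 sZ sZ' sW p.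
have -> : (fun p => 1 *: Z p + Z' p) = (fun p => Z p + Z' p).
  by apply: functional_extensionality_dep => p'; rewrite scale1r.
rewrite scale1r => ->; rewrite etaD.
have -> : (fun p' => eta L (Z p' + Z' p')) = (fun p' => eta L (Z p') + eta L (Z' p')).
  by apply/funext => p'; rewrite etaD.
rewrite (tangentD sT (psection_tangent p sW)); [|exact: eta_smooth|exact: eta_smooth].
have -> : panchor (Z p + Z' p) (fun p' => eta L (W p'))
  = panchor (Z p) (fun p' => eta L (W p')) + panchor (Z' p) (fun p' => eta L (W p')) by [].
ring.
Qed.

(** The terms in which [f] is differentiated cancel by the Leibniz rule. *)
Lemma pd1Z f Z W p : smooth_fun (total_atlas E) f ->
  smooth_psection A Z -> smooth_psection A W ->
  pd1 P (eta L) (fun p' => f p' *: Z p') W p = f p * pd1 P (eta L) Z W p.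
Proof.
move=> sf sZ sW.
have sfZ : smooth_psection A (fun p' => f p' *: Z p').
  apply/smooth_psectionP => p'; apply: psmoothZ; first exact: sf.
  by move/smooth_psectionP: sZ.
rewrite /pd1 (br_anti (pbracketP P) sfZ sW) (br_leibniz (pbracketP P) sW sZ sf).
rewrite (br_anti (pbracketP P) sW sZ) etaN etaD !etaZ etaN.
have -> : (fun p' => eta L (f p' *: Z p')) = (fun p' => f p' * eta L (Z p')).
  by apply/funext => p'; rewrite etaZ.
rewrite (tangentM sT (psection_tangent p sW)); [|exact: sf|exact: eta_smooth].
have -> : panchor (f p *: Z p) (fun p' => eta L (W p'))
  = f p * panchor (Z p) (fun p' => eta L (W p')) by [].
ring.
Qed.

Lemma pd1_sum (I : Type) (r : seq I) (F : I -> ExR E -> R) (Z : I -> psection E)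
    W p :
  (forall i, smooth_fun (total_atlas E) (F i)) ->
  (forall i, smooth_psection A (Z i)) -> smooth_psection A W ->
  pd1 P (eta L) (fun p' => \sum_(i <- r) F i p' *: Z i p') W p =
  \sum_(i <- r) F i p * pd1 P (eta L) (Z i) W p.
Proof.
move=> sF sZ sW.
have ssum (s : seq I) : smooth_psection A (fun p' => \sum_(i <- s) F i p' *: Z i p').
  apply/smooth_psectionP => p'; apply: psmooth_sum => i; first exact: sF.
  by have /smooth_psectionP := sZ i.
elim: r => [|i r IH].
  rewrite big_nil; have := pd1Z p (fun p => smoothT_cst p 0) sW sW.
  rewrite mul0r => <-; congr pd1; apply: functional_extensionality_dep => p'.
  by rewrite big_nil scale0r.
have sFZ : smooth_psection A (fun p' => F i p' *: Z i p').
  apply/smooth_psectionP => p'; apply: psmoothZ; first exact: sF.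
  by have /smooth_psectionP := sZ i.
rewrite big_cons -IH -pd1Z // -pd1D //; congr pd1.
by apply: functional_extensionality_dep => p'; rewrite big_cons.
Qed.

End WithLagrangian.
End PSections.

(** * The Lagrangian equations in an adapted chart *)

Section Equations.
Context {R : realType} {n m : nat} {Q : manifold R n} {E : vbundle Q m}.
Variables (A : lie_algebroid E) (P : prolongation A) (L : ExR E -> R).
Hypothesis hL : smooth_fun (total_atlas E) L.

Let sQ := @manifold_smooth_atlas R n Q.
Let sT := @total_smooth_atlas R n m Q E.
Local Notation smoothT := (smooth_near (total_atlas E)).
Local Notation nearT := (near_pt (total_atlas E)).
Implicit Types (p : ExR E) (Z W G : psection E).

Variables (c : chart R Q n) (e : frame m E).
Hypotheses (Ac : atlas Q c) (Fe : frames E e).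
Let Ace : total_atlas E (adapted c e) := adapted_total Ac Fe.
Let fe := frames_frame Fe.
Local Notation D k f p := (bder A c e k f p).
Local Notation Dy a := (pder (adapted c e) (iy a)).
Local Notation Ds := (pder (adapted c e) i_s).
Local Notation Ly a := (pder (adapted c e) (iy a) L).

Lemma Ly_smooth a p : cdom (adapted c e) p -> smoothT p (Ly a).
Proof. by move=> cp; exact: (smooth_near_pder sT). Qed.

Section Bder.
Variables (k : @pindex m) (p : ExR E).
Hypothesis cp : cdom (adapted c e) p.
Let tk := (pbasis_fibre A Ac Fe k cp).1.

Lemma bder_near_eq f g : nearT p (fun p' => f p' = g p') -> smoothT p f ->
  D k f p = D k g p.
Proof.
move=> fgE sf; have sg := smooth_near_eq sT fgE sf.
by rewrite -!(panchor_basis A Ac Fe) //; exact: (tangent_near_eq sT tk).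
Qed.

Lemma bder_cst a : D k (fun=> a) p = 0.
Proof.
rewrite -(panchor_basis A Ac Fe) //; first exact: (tangent_cst tk).
exact: smoothT_cst.
Qed.

Lemma bderN f : smoothT p f -> D k (fun p' => - f p') p = - D k f p.
Proof.
move=> sf; rewrite -!(panchor_basis A Ac Fe) //; first exact: (tangentN sT tk).
exact: (smooth_nearN sT).
Qed.

Lemma bderB f g : smoothT p f -> smoothT p g ->
  D k (fun p' => f p' - g p') p = D k f p - D k g p.
Proof.
move=> sf sg; rewrite -!(panchor_basis A Ac Fe) //; first exact: (tangentB sT tk).
by apply: (smooth_nearD sT) => //; exact: (smooth_nearN sT).
Qed.

Lemma bderM f g : smoothT p f -> smoothT p g ->
  D k (fun p' => f p' * g p') p = f p * D k g p + g p * D k f p.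
Proof.
move=> sf sg; rewrite -!(panchor_basis A Ac Fe) //; first exact: (tangentM sT tk).
exact: (smooth_nearM sT).
Qed.

Lemma bder_bigsum (F : 'I_m -> ExR E -> R) : (forall i, smoothT p (F i)) ->
  D k (fun p' => \sum_i F i p') p = \sum_i D k (F i) p.
Proof.
move=> sF; rewrite -(panchor_basis A Ac Fe) //.
  rewrite [LHS](tangent_bigsum sT tk (index_enum 'I_m) sF).
  by apply: eq_bigr => i _; rewrite -(panchor_basis A Ac Fe).
exact: (@smooth_near_sum _ _ _ _ sT _ p _ (index_enum 'I_m) xpredT F Ace cp).
Qed.

Lemma energy_smooth : smoothT p (energy L).
Proof.
have : smoothT p (fun p' => \sum_a ycoord e a p' * Ly a p' - L p').
  apply: (smooth_nearD sT); last exact: (smooth_nearN sT).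
  refine (@smooth_near_sum _ _ _ _ sT _ p _ (index_enum 'I_m) xpredT
    (fun a p' => ycoord e a p' * Ly a p') Ace cp _) => a _.
  apply: (smooth_nearM sT); last exact: Ly_smooth.
  by case: cp => _ ep; exact: smooth_ycoord.
apply: (smooth_near_eq sT).
by apply: near_ptS (near_pt_chart sT Ace cp) => p' cp'; rewrite (energyE Ac Fe).
Qed.

Lemma bder_energy :
  D k (energy L) p = \sum_a ycoord e a p * D k (Ly a) p
    + \sum_a pdelta (PV a) k * Ly a p - D k L p.
Proof.
have sy a : smoothT p (ycoord e a) by case: cp => _ ep; exact: smooth_ycoord.
have sF a : smoothT p (fun p' => ycoord e a p' * Ly a p').
  by apply: (smooth_nearM sT) => //; exact: Ly_smooth.
have sS : smoothT p (fun p' => \sum_a ycoord e a p' * Ly a p').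
  exact: (@smooth_near_sum _ _ _ _ sT _ p _ (index_enum 'I_m) xpredT
    (fun a p' => ycoord e a p' * Ly a p') Ace cp).
rewrite (@bder_near_eq _ (fun p' => \sum_a ycoord e a p' * Ly a p' - L p')).
- rewrite bderB // (bder_bigsum sF) -big_split /=; congr (_ - _).
  apply: eq_bigr => a _; rewrite bderM //; last exact: Ly_smooth.
  by rewrite (bder_ycoord A Ac Fe) // [X in _ + X]mulrC.
- by apply: near_ptS (near_pt_chart sT Ace cp) => p' cp'; rewrite (energyE Ac Fe).
- exact: energy_smooth.
Qed.

End Bder.

(** The coefficients of [eta = V^s - L_a X^a] in the dual basis. *)
Definition etab (k : @pindex m) : ExR E -> R :=
  match k with
  | PX a => fun p => - Ly a p
  | PV _ => fun=> 0
  | PS => fun=> 1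
  end.

Lemma etab_smooth k p : cdom (adapted c e) p -> smoothT p (etab k).
Proof.
move=> cp; case: k => [a|a|] /=; try exact: smoothT_cst.
by apply: (smooth_nearN sT); exact: Ly_smooth.
Qed.

Lemma eta_basis k p : cdom (adapted c e) p -> eta L (pbasis A c e k p) = etab k p.
Proof.
move=> cp; rewrite (etaE Ac Fe _ cp) // (pdual_basis A Ac Fe) //.
under eq_bigr => a _ do rewrite (pdual_basis A Ac Fe) //.
case: k => [a|a|] /=.
- rewrite sub0r (bigD1 a) //= eqxx mul1r big1 ?addr0 // => b ba.
  by rewrite (negPf ba) mul0r.
- by rewrite big1 ?subr0 // => b _; rewrite mul0r.
- by rewrite big1 ?subr0 // => b _; rewrite mul0r.
Qed.

Lemma eta_expand p (z : prol p) : cdom (adapted c e) p -> prol_fibre A z ->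
  eta L z = \sum_(k <- pindices m) pdual e k z * etab k p.
Proof.
move=> cp zA; rewrite {1}(prol_expand Ac Fe cp zA) (eta_sum hL).
by apply: eq_bigr => k _; rewrite (etaZ hL) eta_basis.
Qed.

Variable C : 'I_m -> 'I_m -> 'I_m -> Q -> R.
Hypothesis hC : structure_functions A e C.

(** [d eta] on the basis sections of indices [k] and [l]. *)
Definition omega (k l : @pindex m) (p : ExR E) : R :=
  D k (etab l) p - D l (etab k) p -
  match k, l with
  | PX a, PX b => \sum_g C g a b (base p) * etab (PX g) p
  | _, _ => 0
  end.

Section AtPoint.
Variable p : ExR E.
Hypothesis cp : cdom (adapted c e) p.
Variable chi : Q -> R.
Hypothesis hchi : cutoff (base p) (cdom c `&` fdom e) chi.

(** Global sections that coincide with the basis sections near [p]: the bracket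
    only accepts global sections. *)
Definition cutb (k : @pindex m) : psection E :=
  fun p' => chi (base p') *: pbasis A c e k p'.

Lemma cutb_smooth k : smooth_psection A (cutb k).
Proof.
by apply: (cut_psection_smooth hchi) => p' [cp' ep']; exact: psmooth_basis.
Qed.

Lemma cutb_near k : nearT p (fun p' => cutb k p' = pbasis A c e k p').
Proof.
have [_ chi1 _] := hchi.
by apply: near_ptS (near_base chi1) => p' /= chi1'; rewrite /cutb chi1' scale1r.
Qed.

Lemma cutb_self k : cutb k p = pbasis A c e k p.
Proof. exact: (near_pt_self sT (cutb_near k)). Qed.

(** Cutting off twice turns the local expansion of [Z] in the basis into a
    global identity, to which tensoriality applies. *)
Lemma pd1_expand Z W : smooth_psection A Z -> smooth_psection A W ->
  pd1 P (eta L) Z W p =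
  \sum_(k <- pindices m) pdual e k (Z p) * pd1 P (eta L) (cutb k) W p.
Proof.
move=> sZ sW; have chi1 := cutoff_self hchi; have [schi _ _] := hchi.
pose F k p' := chi (base p') * pdual e k (Z p').
have sF k : smooth_fun (total_atlas E) (F k).
  by apply: (cut_fun_smooth hchi) => p' [cp' ep']; case: sZ => _; exact.
have schi2 : smooth_fun (total_atlas E) (fun p' => chi (base p') * chi (base p')).
  by move=> p'; apply: (smooth_nearM sT); apply: smooth_base; exact: schi.
have := pd1Z hL P p schi2 sZ sW; rewrite chi1 !mul1r => <-.
have -> : (fun p' => (chi (base p') * chi (base p')) *: Z p') =
    (fun p' => \sum_(k <- pindices m) F k p' *: cutb k p').
  apply: functional_extensionality_dep => p'.
  have [cp'|nU] := pselect ((cdom c `&` fdom e) (base p')); last first.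
    rewrite (cutoff_out hchi nU) mul0r scale0r big1 // => k _.
    by rewrite /cutb (cutoff_out hchi nU) scale0r scaler0.
  rewrite {1}(prol_expand Ac Fe cp' (sZ.1 p')) scaler_sumr.
  by apply: eq_bigr => k _; rewrite /F /cutb !scalerA mulrAC.
rewrite (pd1_sum hL) //; last exact: cutb_smooth.
by apply: eq_bigr => k _; rewrite /F chi1 mul1r.
Qed.

Lemma pd1_basis k l : pd1 P (eta L) (cutb k) (cutb l) p = omega k l p.
Proof.
have eb j : nearT p (fun p' => eta L (cutb j p') = etab j p').
  apply: near_ptS (near_ptI sT (cutb_near j) (near_pt_chart sT Ace cp)) => p'.
  by move=> [-> cp']; exact: eta_basis.
have ba i j : panchor (cutb i p) (fun p' => eta L (cutb j p')) = D i (etab j) p.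
  have ti : tangent (total_atlas E) p (panchor (pbasis A c e i p)).
    exact: (pbasis_fibre A Ac Fe i cp).1.
  rewrite cutb_self (tangent_near_eq sT ti (eb j)) -(panchor_basis A Ac Fe) //.
  exact: etab_smooth.
rewrite /pd1 !ba /omega; congr (_ - _ - _).
rewrite (pbracket_basis P Ac Fe hC cp (cutb_smooth k) (cutb_smooth l)
  (cutb_near k) (cutb_near l)).
have e0 : eta L (0 : prol p) = 0.
  by rewrite -[0 in LHS](scale0r (0 : prol p)) (etaZ hL) mul0r.
case: k => [a|a|]; case: l => [b|b|] //; rewrite (eta_sum hL).
by apply: eq_bigr => g _; rewrite (etaZ hL) eta_basis.
Qed.

Lemma pd1_testE Z l : smooth_psection A Z ->
  pd1 P (eta L) Z (cutb l) p =
  \sum_(k <- pindices m) pdual e k (Z p) * omega k l p.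
Proof.
move=> sZ; rewrite (pd1_expand sZ (cutb_smooth l)).
by apply: eq_bigr => k _; rewrite pd1_basis.
Qed.

Lemma pd1_testV Z b : smooth_psection A Z ->
  pd1 P (eta L) Z (cutb (PV b)) p =
  \sum_a pdual e (PX a) (Z p) * D (PV b) (Ly a) p.
Proof.
move=> sZ; rewrite pd1_testE // pindices_sum.
rewrite [X in _ + (X + _)]big1; last first.
  by move=> a _; rewrite /omega /etab !(bder_cst _ cp) !subr0 mulr0.
rewrite {2}/omega /etab !(bder_cst _ cp) !subr0 mulr0 !addr0.
apply: eq_bigr => a _; congr (_ * _).
rewrite /omega /etab !(bder_cst _ cp) (bderN _ cp (Ly_smooth a cp)).
by rewrite sub0r opprK subr0.
Qed.

Lemma pd1_testS Z : smooth_psection A Z ->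
  pd1 P (eta L) Z (cutb (@PS m)) p =
  \sum_a pdual e (PX a) (Z p) * D (@PS m) (Ly a) p.
Proof.
move=> sZ; rewrite pd1_testE // pindices_sum.
rewrite [X in _ + (X + _)]big1; last first.
  by move=> a _; rewrite /omega /etab !(bder_cst _ cp) !subr0 mulr0.
rewrite {2}/omega /etab !(bder_cst _ cp) !subr0 mulr0 !addr0.
apply: eq_bigr => a _; congr (_ * _).
rewrite /omega /etab !(bder_cst _ cp) (bderN _ cp (Ly_smooth a cp)).
by rewrite sub0r opprK subr0.
Qed.

Lemma pd1_testX Z b : smooth_psection A Z ->
  pd1 P (eta L) Z (cutb (PX b)) p =
  \sum_a pdual e (PX a) (Z p) * (D (PX b) (Ly a) p - D (PX a) (Ly b) p
    + \sum_g C g a b (base p) * Ly g p)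
  - \sum_a pdual e (PV a) (Z p) * D (PV a) (Ly b) p
  - pdual e (@PS m) (Z p) * D (@PS m) (Ly b) p.
Proof.
move=> sZ; rewrite pd1_testE // pindices_sum -addrA; congr (_ + _).
  apply: eq_bigr => a _; congr (_ * _).
  rewrite /omega /etab !(bderN _ cp (Ly_smooth _ cp)).
  under [X in _ - X = _]eq_bigr => g _ do rewrite mulrN.
  by rewrite sumrN !opprK [- _ + D (PX b) _ _]addrC.
congr (_ + _).
  rewrite -sumrN; apply: eq_bigr => a _.
  rewrite /omega /etab (bderN _ cp (Ly_smooth b cp)) (bder_cst _ cp).
  by rewrite !subr0 mulrN.
rewrite /omega /etab (bderN _ cp (Ly_smooth b cp)) (bder_cst _ cp).
by rewrite !subr0 mulrN.
Qed.

(** ** Pointwise form of the equations *)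

(** What the Herglotz equation leaves for the term [g^a d^2L/dy^a dy^b] once its
    left-hand side is expanded by the chain rule. *)
Definition herglotz_rhs (b : 'I_m) (p' : ExR E) : R :=
  \sum_a ycoord e a p' *
     (\sum_g C g a b (base p') * Ly g p' - D (PX a) (Ly b) p')
  + D (PX b) L p' - L p' * D (@PS m) (Ly b) p' + Ly b p' * D (@PS m) L p'.

Definition hessian (p' : ExR E) : 'M[R]_m := \matrix_(a, b) D (PV a) (Ly b) p'.

Hypothesis hreg : hessian p \in unitmx.

(** The accelerations enter the equations through the rows of the Hessian, the
    velocities through its columns. *)
Lemma hessian_left (v w : 'I_m -> R) :
  (forall b, \sum_a v a * D (PV a) (Ly b) p = \sum_a w a * D (PV a) (Ly b) p) ->
  forall a, v a = w a.
Proof.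
move=> vw; suff /rowP vwE : \row_a v a = \row_a w a.
  by move=> a; have := vwE a; rewrite !mxE.
apply: (can_inj (mulmxK hreg)); apply/rowP => b; rewrite !mxE.
under eq_bigr => a _ do rewrite !mxE.
by rewrite vw; apply: eq_bigr => a _; rewrite !mxE.
Qed.

Lemma hessian_right (v w : 'I_m -> R) :
  (forall b, \sum_a v a * D (PV b) (Ly a) p = \sum_a w a * D (PV b) (Ly a) p) ->
  forall a, v a = w a.
Proof.
move=> vw; suff /colP vwE : \col_a v a = \col_a w a.
  by move=> a; have := vwE a; rewrite !mxE.
apply: (can_inj (mulKmx hreg)); apply/colP => b; rewrite !mxE.
under eq_bigr => a _ do rewrite !mxE mulrC.
by rewrite vw; apply: eq_bigr => a _; rewrite !mxE mulrC.
Qed.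

Lemma bder_energyX b : D (PX b) (energy L) p =
  \sum_a ycoord e a p * D (PX b) (Ly a) p - D (PX b) L p.
Proof.
rewrite bder_energy //; congr (_ - _); rewrite [X in _ + X]big1 ?addr0 //.
by move=> a _; rewrite mul0r.
Qed.

Lemma bder_energyV b : D (PV b) (energy L) p =
  \sum_a ycoord e a p * D (PV b) (Ly a) p.
Proof.
rewrite bder_energy //.
have -> : \sum_a pdelta (PV a) (PV b) * Ly a p = D (PV b) L p.
  rewrite (bigD1 b) //= eqxx mul1r big1 ?addr0 // => a ab.
  by rewrite (negPf ab) mul0r.
by rewrite addrK.
Qed.

Lemma bder_energyS : D (@PS m) (energy L) p =
  \sum_a ycoord e a p * D (@PS m) (Ly a) p - D (@PS m) L p.
Proof.
rewrite bder_energy //; congr (_ - _); rewrite [X in _ + X]big1 ?addr0 //.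
by move=> a _; rewrite mul0r.
Qed.

Variable Reeb : psection E.
Hypothesis hReeb : is_reeb P L Reeb.

(** In coordinates the Reeb section is [V_s - W^(ab) (dL_b/ds) V_a], where
    [W^(ab)] is the inverse of the Hessian, so it annihilates every [L_b].  Hence
    [R_L (E_L) = R_L (y^b) L_b - R_L (L)], and the derivatives of [L] along the
    fibre cancel. *)
Lemma reeb_energy : panchor (Reeb p) (energy L) = - D (@PS m) L p.
Proof.
have [sR dR eR] := hReeb.
have RX a : pdual e (PX a) (Reeb p) = 0.
  apply: (hessian_right (v := fun a => pdual e (PX a) (Reeb p)) (w := fun=> 0)) => b.
  rewrite -(pd1_testV b sR) dR; last exact: cutb_smooth.
  by rewrite big1 // => d _; rewrite mul0r.
have RS : pdual e (@PS m) (Reeb p) = 1.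
  have := eR p; rewrite (etaE Ac Fe _ cp) // big1 ?subr0 //.
  by move=> a _; rewrite RX mul0r.
have RV b : \sum_a pdual e (PV a) (Reeb p) * D (PV a) (Ly b) p
    = - D (@PS m) (Ly b) p.
  have := dR _ (cutb_smooth (PX b)) p; rewrite (pd1_testX b sR) RS mul1r.
  rewrite big1 => [|a _]; last by rewrite RX mul0r.
  by rewrite sub0r => /eqP; rewrite subr_eq0 => /eqP <-; rewrite opprK.
rewrite (panchor_expand (A := A) Ac Fe cp _ (energy_smooth cp)); last by case: sR.
rewrite pindices_sum big1 ?add0r => [|a _]; last by rewrite RX mul0r.
rewrite RS mul1r bder_energyS.
have -> : \sum_a pdual e (PV a) (Reeb p) * D (PV a) (energy L) p
    = - \sum_b ycoord e b p * D (@PS m) (Ly b) p.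
  under eq_bigr => a _ do rewrite bder_energyV mulr_sumr.
  rewrite exchange_big /= -sumrN; apply: eq_bigr => b _.
  rewrite -mulrN -RV mulr_sumr; apply: eq_bigr => a _.
  by rewrite mulrCA.
by rewrite addrA addNr add0r.
Qed.

Definition lagrangian_at (G : psection E) (p' : ExR E) : Prop :=
  eta L (G p') = - energy L p' /\
  forall W, smooth_psection A W ->
    pd1 P (eta L) G W p' =
    pd0 (energy L) W p' - pd0 (energy L) Reeb p' * eta L (W p').

Definition lagrangian_coords (p' : ExR E) (z : prol p') : Prop :=
  [/\ forall a, pdual e (PX a) z = ycoord e a p',
      forall b, \sum_a pdual e (PV a) z * D (PV a) (Ly b) p' = herglotz_rhs b p'
    & pdual e (@PS m) z = L p'].

(** Both sides are linear over functions in [W], so the basis sections suffice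
    as test sections. *)
Lemma lagrangian_test G : smooth_psection A G ->
  (forall W, smooth_psection A W -> pd1 P (eta L) G W p =
     pd0 (energy L) W p - pd0 (energy L) Reeb p * eta L (W p)) <->
  (forall k, pd1 P (eta L) G (cutb k) p =
     D k (energy L) p + D (@PS m) L p * etab k p).
Proof.
move=> sG.
have rE : pd0 (energy L) Reeb p = - D (@PS m) L p by exact: reeb_energy.
split=> [H k|H W sW].
  rewrite H; last exact: cutb_smooth.
  rewrite rE mulNr opprK /pd0 cutb_self (panchor_basis A Ac Fe) //.
    by rewrite eta_basis.
  exact: energy_smooth.
have WA := sW.1 p.
rewrite (pd1_anti hL P p sG sW) (pd1_expand sW sG) rE mulNr opprK.
rewrite /pd0 (panchor_expand (A := A) Ac Fe cp WA (energy_smooth cp)).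
rewrite (eta_expand cp WA) mulr_sumr -big_split /= -sumrN.
apply: eq_bigr => k _.
rewrite (pd1_anti hL P p (cutb_smooth k) sG) H mulrN opprK mulrDr.
by congr (_ + _); rewrite mulrCA.
Qed.

(** The equation for [eta] gives the component along [V_s], the test section
    [V_b] the components along [X_a], and [X_b] those along [V_a]; the test
    section [V_s] then holds by the value of [R_L (E_L)]. *)
Lemma lagrangian_coordsP G : smooth_psection A G ->
  lagrangian_at G p <-> lagrangian_coords (G p).
Proof.
move=> sG.
have eG : eta L (G p) = pdual e (@PS m) (G p)
    - \sum_a pdual e (PX a) (G p) * Ly a p by exact: etaE.
have splitX b : (forall a, pdual e (PX a) (G p) = ycoord e a p) ->
    \sum_a pdual e (PX a) (G p) * (D (PX b) (Ly a) p - D (PX a) (Ly b) p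
      + \sum_g C g a b (base p) * Ly g p) =
    \sum_a ycoord e a p * D (PX b) (Ly a) p +
    \sum_a ycoord e a p * (\sum_g C g a b (base p) * Ly g p - D (PX a) (Ly b) p).
  move=> GX; rewrite -[RHS]big_split; apply: eq_bigr => a _.
  by rewrite GX -addrA [- _ + _]addrC; exact: mulrDr.
have alg (S1 S2 V x y z w : R) :
    S1 + S2 - V - x = S1 - y - z * w <-> V = S2 + y - x + w * z.
  by split=> H; lra.
split.
  move=> [hE /(lagrangian_test sG) hd].
  have GX a : pdual e (PX a) (G p) = ycoord e a p.
    apply: (hessian_right (v := fun a => pdual e (PX a) (G p))
      (w := fun a => ycoord e a p)) => b.
    by rewrite -(pd1_testV b sG) hd bder_energyV /etab mulr0 addr0.
  have GS : pdual e (@PS m) (G p) = L p.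
    move: hE; rewrite eG (energyE Ac Fe) //.
    under eq_bigr => a _ do rewrite GX.
    by rewrite opprB => /addIr.
  split=> // b; have := hd (PX b).
  rewrite (pd1_testX b sG) bder_energyX (splitX b GX) GS /etab mulrN => /alg ->.
  by [].
move=> [GX GV GS]; split.
  rewrite eG (energyE Ac Fe) // GS.
  under eq_bigr => a _ do rewrite GX.
  by rewrite opprB.
apply/(lagrangian_test sG) => -[b|b|].
- rewrite (pd1_testX b sG) bder_energyX (splitX b GX) GS /etab mulrN.
  by apply/alg; rewrite GV.
- rewrite (pd1_testV b sG) bder_energyV /etab mulr0 addr0.
  by apply: eq_bigr => a _; rewrite GX.
- rewrite (pd1_testS sG) bder_energyS /etab mulr1 subrK.
  by apply: eq_bigr => a _; rewrite GX.
Qed.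

Lemma lagrangian_coords_unique (z z' : prol p) :
  prol_fibre A z -> prol_fibre A z' ->
  lagrangian_coords z -> lagrangian_coords z' -> z = z'.
Proof.
move=> zA z'A [zX zV zS] [z'X z'V z'S].
apply: (prol_ext Ac Fe cp zA z'A) => -[a|a|].
- by rewrite zX z'X.
- apply: (hessian_left (v := fun a => pdual e (PV a) z)
    (w := fun a => pdual e (PV a) z')) => b.
  by rewrite zV z'V.
- by rewrite zS z'S.
Qed.

End AtPoint.
End Equations.

(** * Inverses of smooth matrices *)

Section SmoothMatrices.
Context {R : realType} {T : Type} {k : nat} {A : set (chart R T k)}.
Hypothesis sA : smooth_atlas A.
Variables (c : chart R T k) (p : T).
Hypotheses (Ac : A c) (cp : cdom c p).

Lemma smooth_det l (M : T -> 'M[R]_l) :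
  (forall i j, smooth_near A p (fun p' => M p' i j)) ->
  smooth_near A p (fun p' => \det (M p')).
Proof.
move=> sM; rewrite /determinant.
refine (@smooth_near_sum _ _ _ _ sA _ p _ _ xpredT
  (fun (s : {perm 'I_l}) p' => (-1) ^+ s * \prod_i M p' i (s i)) Ac cp _) => s _.
apply: (smooth_nearZ sA).
exact: (@smooth_near_prod _ _ _ _ sA _ p _ _ xpredT
  (fun i p' => M p' i (s i)) Ac cp).
Qed.

Lemma smooth_invmx l (M : T -> 'M[R]_l) i j :
  (forall i j, smooth_near A p (fun p' => M p' i j)) ->
  near_pt A p (fun p' => M p' \in unitmx) ->
  smooth_near A p (fun p' => invmx (M p') i j).
Proof.
move=> sM uM.
have : smooth_near A p (fun p' => (\det (M p'))^-1 * \adj (M p') i j).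
  apply: (smooth_nearM sA).
    apply: (smooth_nearV sA); last exact: smooth_det.
    by have := near_pt_self sA uM; rewrite unitmxE unitfE.
  have -> : (fun p' => \adj (M p') i j) =
      (fun p' => (-1) ^+ (j + i) * \det (row' j (col' i (M p')))).
    by apply/funext => p'; rewrite mxE.
  apply: (smooth_nearZ sA); apply: smooth_det => i' j'.
  have -> : (fun p' => row' j (col' i (M p')) i' j') =
      (fun p' => M p' (lift j i') (lift i j')).
    by apply/funext => p'; rewrite !mxE.
  exact: sM.
apply: (smooth_near_eq sA); apply: near_ptS uM => p' uM'.
by rewrite /invmx uM' [in RHS]mxE.
Qed.

End SmoothMatrices.

(** * The Lagrangian section *)

Section Existence.
Context {R : realType} {n m : nat} {Q : manifold R n} {E : vbundle Q m}.
Variables (A : lie_algebroid E) (P : prolongation A) (L : ExR E -> R)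
  (Reeb : psection E).
Hypotheses (hL : smooth_fun (total_atlas E) L) (hreg : regular L)
  (hReeb : is_reeb P L Reeb).

Let sQ := @manifold_smooth_atlas R n Q.
Let sT := @total_smooth_atlas R n m Q E.
Local Notation smoothT := (smooth_near (total_atlas E)).
Local Notation nearT := (near_pt (total_atlas E)).
Implicit Types (p : ExR E) (G : psection E) (c : chart R Q n) (e : frame m E).

Lemma regular_hessian c e p : atlas Q c -> frames E e -> cdom (adapted c e) p ->
  hessian A L c e p \in unitmx.
Proof.
by move=> Ac Fe cp; exact: (hreg Ac Fe cp).
Qed.

Lemma chart_cutoff c e p : atlas Q c -> frames E e -> cdom (adapted c e) p ->
  exists chi, cutoff (base p) (cdom c `&` fdom e) chi.
Proof.
move=> Ac Fe cp; apply: cutoff_exists => //.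
by apply: openI; [exact: chart_dom_open (atlas_chart Ac)|
  exact: frame_dom_open (frames_frame Fe)].
Qed.

Lemma lagrangian_atP c e C p G : atlas Q c -> frames E e ->
  structure_functions A e C -> cdom (adapted c e) p -> smooth_psection A G ->
  lagrangian_at P L Reeb G p <-> lagrangian_coords A L c e C (G p).
Proof.
move=> Ac Fe hC cp sG; have [chi hchi] := chart_cutoff Ac Fe cp.
exact: (lagrangian_coordsP hL Ac Fe hC cp hchi (regular_hessian Ac Fe cp) hReeb sG).
Qed.

Lemma lagrangian_at_unique p G G' : smooth_psection A G -> smooth_psection A G' ->
  lagrangian_at P L Reeb G p -> lagrangian_at P L Reeb G' p -> G p = G' p.
Proof.
move=> sG sG'; have [c [e [Ac Fe cp]]] := total_cover p.
have [C hC _] := structure_functions_exist A Fe.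
move=> /(lagrangian_atP Ac Fe hC cp sG) hG /(lagrangian_atP Ac Fe hC cp sG') hG'.
exact: (lagrangian_coords_unique Ac Fe cp (regular_hessian Ac Fe cp)
  (sG.1 p) (sG'.1 p) hG hG').
Qed.

Lemma herglotz_rhs_smooth c e C b p : atlas Q c -> frames E e ->
  cdom (adapted c e) p ->
  (forall q, fdom e q -> forall g a b, smooth_near (atlas Q) q (C g a b)) ->
  smoothT p (herglotz_rhs A L c e C b).
Proof.
move=> Ac Fe cp sC; have Ace := adapted_total Ac Fe; have [cq eq] := cp.
have sLy a : smoothT p (pder (adapted c e) (iy a) L) by exact: Ly_smooth.
have sD k f : smoothT p f -> smoothT p (bder A c e k f) by exact: bder_smooth.
have sN f := smooth_nearN sT (p := p) (f := f).
rewrite /herglotz_rhs.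
apply: (smooth_nearD sT); last by apply: (smooth_nearM sT) => //; exact: sD.
apply: (smooth_nearD sT); last first.
  by apply: sN; apply: (smooth_nearM sT) => //; exact: sD.
apply: (smooth_nearD sT); last exact: sD.
refine (@smooth_near_sum _ _ _ _ sT _ p _ (index_enum 'I_m) xpredT
  (fun a p' => ycoord e a p' * (\sum_g C g a b (base p') *
     pder (adapted c e) (iy g) L p'
     - bder A c e (PX a) (pder (adapted c e) (iy b) L) p')) Ace cp _) => a _.
apply: (smooth_nearM sT); first exact: smooth_ycoord.
apply: (smooth_nearD sT); last by apply: sN; exact: sD.
refine (@smooth_near_sum _ _ _ _ sT _ p _ (index_enum 'I_m) xpredT
  (fun g p' => C g a b (base p') * pder (adapted c e) (iy g) L p') Ace cp _) => g _.
apply: (smooth_nearM sT) => //.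
exact: (smooth_base (f := C g a b) (sC _ eq g a b)).
Qed.

(** Solving the linear system for the accelerations gives a smooth solution
    over a chart; it is cut off in the base only. *)
Lemma local_solution p : exists2 G, smooth_psection A G &
  nearT p (fun p' => lagrangian_at P L Reeb G p').
Proof.
have [c [e [Ac Fe cp]]] := total_cover p; have Ace := adapted_total Ac Fe.
have [C hC sC] := structure_functions_exist A Fe.
have [chi hchi] := chart_cutoff Ac Fe cp.
pose acc b p' := \sum_a herglotz_rhs A L c e C a p'
  * invmx (hessian A L c e p') a b.
pose g (k : @pindex m) : ExR E -> R :=
  match k with PX a => ycoord e a | PV a => acc a | PS => L end.
pose Z : psection E := fun p' => \sum_(k <- pindices m) g k p' *: pbasis A c e k p'.
have sg k p' : cdom (adapted c e) p' -> smoothT p' (g k).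
  move=> cp'; case: k => [a|a|] /=; last exact: hL.
    by case: cp' => _ ep'; exact: smooth_ycoord.
  refine (@smooth_near_sum _ _ _ _ sT _ p' _ (index_enum 'I_m) xpredT
    (fun b p' => herglotz_rhs A L c e C b p' * invmx (hessian A L c e p') b a)
    Ace cp' _) => b _.
  apply: (smooth_nearM sT); first exact: herglotz_rhs_smooth.
  apply: (smooth_invmx sT Ace cp') => [i j|].
    have -> : (fun p' => hessian A L c e p' i j) =
        bder A c e (PV i) (pder (adapted c e) (iy j) L).
      by apply/funext => p''; rewrite mxE.
    by apply: bder_smooth => //; exact: Ly_smooth.
  by apply: near_ptS (near_pt_chart sT Ace cp') => p''; exact: regular_hessian.
have sG : smooth_psection A (fun p' => chi (base p') *: Z p').
  apply: (cut_psection_smooth hchi) => p' cp'.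
  by apply: psmooth_sum => k; [exact: sg|exact: psmooth_basis].
exists (fun p' => chi (base p') *: Z p') => //.
have [_ chi1 _] := hchi.
apply: near_ptS (near_ptI sT (near_base chi1) (near_pt_chart sT Ace cp)).
move=> p' [/= chip' cp']; apply/(lagrangian_atP Ac Fe hC cp' sG).
rewrite chip' scale1r /Z; split=> [a|b|]; rewrite ?(pdual_comb A Ac Fe) //.
under eq_bigr => a _ do rewrite (pdual_comb A Ac Fe) //.
have := regular_hessian Ac Fe cp' => /mulmxKV.
move=> /(_ 1%N (\row_a herglotz_rhs A L c e C a p')) /rowP /(_ b).
rewrite [in RHS]mxE => <-; rewrite mxE; apply: eq_bigr => a _.
rewrite mxE [hessian A L c e p' a b]mxE; congr (_ * _).
by apply: eq_bigr => d _; rewrite mxE.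
Qed.

Lemma lagrangian_sectionP G : lagrangian_section P L Reeb G <->
  smooth_psection A G /\ forall p, lagrangian_at P L Reeb G p.
Proof.
split=> [[sG hE hd]|[sG H]].
  by split=> // p; split; [exact: hE|move=> W sW; exact: hd].
by split=> // [p|W sW p]; case: (H p) => // _; exact.
Qed.

(** Two local solutions agree wherever both solve the equations, so they glue. *)
Lemma lagrangian_section_exists : exists G, lagrangian_section P L Reeb G.
Proof.
have ex p : exists z : prol p, exists G, [/\ smooth_psection A G, G p = z &
    lagrangian_at P L Reeb G p].
  have [G sG nG] := local_solution p.
  by exists (G p), G; split=> //; exact: (near_pt_self sT nG).
pose G p := projT1 (cid (ex p)).
have GP p : exists G', [/\ smooth_psection A G', G' p = G p &
    lagrangian_at P L Reeb G' p] by exact: projT2 (cid (ex p)).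
exists G.
have nearG p : exists G', [/\ smooth_psection A G', nearT p (fun p' => G' p' = G p')
    & lagrangian_at P L Reeb G' p].
  have [G' sG' nG'] := local_solution p; exists G'; split=> //.
    (* both [G'] and the section chosen at [p'] solve the equations at [p'] *)
    apply: near_ptS nG' => p' hG'; have [G'' [sG'' <- hG'']] := GP p'.
    exact: lagrangian_at_unique.
  exact: (near_pt_self sT nG').
have sG : smooth_psection A G.
  apply/smooth_psectionP => p; have [G' [sG' G'G _]] := nearG p.
  by apply: psmooth_near_eq G'G _; have /smooth_psectionP := sG'.
apply/lagrangian_sectionP; split=> // p.
have [c [e [Ac Fe cp]]] := total_cover p.
have [C hC _] := structure_functions_exist A Fe.
have [G' [sG' G'G /(lagrangian_atP Ac Fe hC cp sG') hG']] := nearG p.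
apply/(lagrangian_atP Ac Fe hC cp sG).
by rewrite -(near_pt_self sT G'G).
Qed.

Lemma lagrangian_section_sode G : lagrangian_section P L Reeb G -> sode G.
Proof.
move=> /lagrangian_sectionP [sG hG] p.
have [c [e [Ac Fe cp]]] := total_cover p; have [_ ep] := cp.
have [C hC _] := structure_functions_exist A Fe.
have /(lagrangian_atP Ac Fe hC cp sG) [GX _ _] := hG p.
rewrite /vertical_endo /liouville; congr (0, vlift _).
apply: (fco_inj (frames_frame Fe) ep); apply/rowP => a; exact: GX.
Qed.

Lemma lagrangian_section_herglotz G (I : set R) (cv : R -> ExR E) c e C t :
  lagrangian_section P L Reeb G -> integral_curve G I cv ->
  atlas Q c -> frames E e -> structure_functions A e C ->
  I t -> cdom (adapted c e) (cv t) -> herglotz_at A L c e C cv t.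
Proof.
move=> /lagrangian_sectionP [sG hG] hcv Ac Fe hC It cp.
have Ace := adapted_total Ac Fe; have [cq eq] := cp.
have /(lagrangian_atP Ac Fe hC cp sG) [GX GV GS] := hG (cv t).
have expand f : smoothT (cv t) f -> panchor (G (cv t)) f =
    \sum_a ycoord e a (cv t) * bder A c e (PX a) f (cv t) +
    (\sum_a pdual e (PV a) (G (cv t)) * bder A c e (PV a) f (cv t)
     + L (cv t) * bder A c e (@PS m) f (cv t)).
  move=> sf; rewrite (panchor_expand (A := A) Ac Fe cp (sG.1 _) sf) pindices_sum GS.
  by under eq_bigr => a _ do rewrite GX.
split.
- move=> b; have sL : smoothT (cv t) (pder (adapted c e) (iy b) L) by exact: Ly_smooth.
  apply: (is_derive_eq (hcv t It _ sL)); rewrite (expand _ sL) GV.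
  have anti : \sum_a ycoord e a (cv t) *
      (\sum_g C g a b (base (cv t)) * pder (adapted c e) (iy g) L (cv t)
       - bder A c e (PX a) (pder (adapted c e) (iy b) L) (cv t)) =
    - (\sum_a \sum_g ycoord e a (cv t) * C g b a (base (cv t))
         * pder (adapted c e) (iy g) L (cv t))
    - \sum_a ycoord e a (cv t)
         * bder A c e (PX a) (pder (adapted c e) (iy b) L) (cv t).
    rewrite -sumrN -sumrB; apply: eq_bigr => a _.
    rewrite mulrBr mulr_sumr -sumrN; congr (_ - _); apply: eq_bigr => g _.
    by rewrite (structure_functions_anti g a b Fe hC eq) mulNr mulrN mulrA.
  have alg (U T X S K : R) : U + (- T - U + X - S + K + S) = X - T + K by ring.
  by rewrite /herglotz_rhs anti; exact: alg.
- move=> i.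
  have sc : smooth_near (atlas Q) (base (cv t)) (fun q => cmap c q 0 i).
    exact: (smooth_near_coord sQ).
  have sci := smooth_base sc.
  apply: (is_derive_eq (hcv t It _ sci)).
  have [_ anc] := sG.1 (cv t).
  rewrite /panchor -(anc _ sc) (anchor_frame A Fe) //.
  apply: eq_bigr => a _; congr (_ * _); exact: GX.
- have ss := smooth_scoord (cv t).
  by apply: (is_derive_eq (hcv t It _ ss)); exact: GS.
Qed.

End Existence.

Unset Implicit Arguments.
Set Strict Implicit.

Theorem theorem4p9 (R : realType) (n m : nat) (Q : manifold R n)
    (E : vbundle Q m) (A : lie_algebroid E) (P : prolongation A)
    (L : ExR E -> R) (Reeb : psection E)
    (hL : smooth_fun (total_atlas E) L)
    (hreg : regular L)
    (hReeb : is_reeb P L Reeb) :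
  (exists! G : psection E, lagrangian_section P L Reeb G) /\
  (forall G : psection E, lagrangian_section P L Reeb G ->
     sode G /\
     (forall (I : set R) (cv : R -> ExR E),
        open I -> is_interval I -> integral_curve G I cv ->
        forall (c : chart R Q n) (e : frame m E)
               (C : 'I_m -> 'I_m -> 'I_m -> Q -> R),
          atlas Q c -> frames E e -> structure_functions A e C ->
          forall t : R, I t -> cdom (adapted c e) (cv t) ->
            herglotz_at A L c e C cv t)).
Proof.
split.
  have [G hG] := lagrangian_section_exists hL hreg hReeb.
  exists G; split=> // G' hG'.
  have /lagrangian_sectionP[sG GL] := hG; have /lagrangian_sectionP[sG' GL'] := hG'.
  apply: functional_extensionality_dep => p.
  exact: (lagrangian_at_unique hL hreg hReeb sG sG').
move=> G hG; split; first exact: (lagrangian_section_sode hL hreg hReeb).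
move=> I cv _ _ hcv c e C Ac Fe hC t It cp.
exact: (lagrangian_section_herglotz hL hreg hReeb hG hcv).
Qed.
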